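(* Let $C$ be any constant with $0<C<1/\log 4$. Then, as $N\to\infty$, uniformly over all intervals $I\subseteq\mathbb{R}$ of length $|I|>\exp\!\left(-C(\log N)^2\right)$, \[ \mathbb{P}[X_N\in I]=\int_I g(x)\,\mathrm{d}x + o(|I|), \] where \[ g(x):=2\int_0^{+\infty}\cos(2\pi u x)\prod_{n=1}^{+\infty}\cos(2\pi u/n)\,\mathrm{d}u . \]
   Context: For a positive integer $N$, $X_N:=\sum_{n=1}^N s_n/n$, where $s_1,\dots,s_N$ are independent random variables, each uniformly distributed on $\{-1,+1\}$. *)

(* Defs.v *)
From Stdlib Require Import Reals Lra List.
From Coquelicot Require Import Coquelicot.
Import ListNotations.
Open Scope R_scope.

(* All sign vectors (s_1,...,s_N) in {-1,+1}^N, encoded as bool lists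
   (true = +1, false = -1); there are exactly 2^N of them, each listed once. *)
Fixpoint all_signs (N : nat) : list (list bool) :=
  match N with
  | O => [[]]
  | S k => map (cons true) (all_signs k) ++ map (cons false) (all_signs k)
  end.

Definition sgn (b : bool) : R := if b then 1 else -1.

(* X_N(s) = sum_{n=1}^{N} s_n / n  (the k-th list entry, 0-based, is s_{k+1}) *)
Fixpoint XN_aux (k : nat) (s : list bool) : R :=
  match s with
  | [] => 0
  | b :: t => sgn b / INR (S k) + XN_aux (S k) t
  end.
Definition XN (s : list bool) : R := XN_aux 0 s.

Definition in_itv (lc rc : bool) (a b x : R) : bool :=
  (if lc then (if Rle_dec a x then true else false)
         else (if Rlt_dec a x then true else false)) &&
  (if rc then (if Rle_dec x b then true else false)
         else (if Rlt_dec x b then true else false)).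

(* P[X_N in I] for independent uniform signs: (#favourable sign vectors)/2^N *)
Definition probXN (N : nat) (lc rc : bool) (a b : R) : R :=
  INR (length (filter (fun s => in_itv lc rc a b (XN s)) (all_signs N))) / 2 ^ N.

Fixpoint prod_cos (u : R) (m : nat) : R :=
  match m with
  | O => 1
  | S k => prod_cos u k * cos (2 * PI * u / INR (S k))
  end.

Definition infprod (u : R) : R := real (Lim_seq (prod_cos u)).

Definition g (x : R) : R :=
  2 * real (Lim (fun T => RInt (fun u => cos (2 * PI * u * x) * infprod u) 0 T) p_infty).

(* Main.v *)
(* Write [rho_N(u) = prod_{n <= N} cos (2 PI u / n)] for the characteristic function
   of [X_N] and [L = ln N].

   For [0 <= u <= N/8] the factors with [4u < n <= 8u] give [|rho_N(u)| <= 2 e^{-u}].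
   For [N/8 < u <= exp (C L^2)], the [k]-th difference of [n |-> 2u/n] is
   [2u k! / (n (n+1) ... (n+k))]; with [k] about [C L] it lies in [[1/4, 1/2]] for many
   [n] of size almost [N], hence in each block of [k+1] consecutive [n] some [2u/n] is at
   distance at least about [2^{-k}] from the integers. Since
   [|cos x| <= exp (- sin^2 x / 2)], this makes [rho_N(u)] smaller than
   [exp (- A L^2)] for every [A].

   Let [P_h] be the Poisson kernel, whose Fourier transform is [e^{- 2 PI h |u|}], and
   let [h = exp (- C1 L^2)] with [C < C1 < 1 / ln 4]. The bounds above yield
   [E P_h (x - X_N) = g x + o(1)] uniformly in [x], and [E P_r (x - X_N) = O(1)] for
   [r >= h]. Finally the indicator of an interval [I] lies between the integrals of
   [P_h - 2 (h/r) P_r] over [I] shrunk by [r] and of [P_h + 2 (h/r) P_r] over [I]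
   enlarged by [r], where [r] is a small multiple of [|I|] and [h = o(r)]. *)
Require Import Defs.
From Stdlib Require Import Arith Factorial Reals Lra Lia List Classical.
From Coquelicot Require Import Coquelicot.
Open Scope R_scope.

(** * Cosine products and sums of squared sines *)

Lemma exp_mono (a b : R) : a <= b -> exp a <= exp b.
Proof. intros [H|H]; [left; apply exp_increasing; auto|right; f_equal; auto]. Qed.

Fixpoint sin2_sum (u : R) (N : nat) : R :=
  match N with
  | O => 0
  | S k => sin2_sum u k + Rsqr (sin (2 * PI * u / INR (S k)))
  end.

(** After squaring, this is [1 - sin^2 <= exp (- sin^2)]. *)
Lemma Rabs_cos_le_exp (x : R) : Rabs (cos x) <= exp (- (Rsqr (sin x) / 2)).
Proof.
  apply Rsqr_incr_0_var; [|left; apply exp_pos].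
  rewrite <- Rsqr_abs, cos2.
  unfold Rsqr at 2; rewrite <- exp_plus.
  replace (- (Rsqr (sin x) / 2) + - (Rsqr (sin x) / 2)) with (- Rsqr (sin x)) by field.
  pose proof (exp_ineq1_le (- Rsqr (sin x))); lra.
Qed.

Lemma Rabs_prod_cos_le_exp (u : R) (N : nat) :
  Rabs (prod_cos u N) <= exp (- (sin2_sum u N / 2)).
Proof.
  induction N as [|k IH]; cbn [prod_cos sin2_sum].
  - rewrite Rabs_R1. replace (- (0 / 2)) with 0 by field. rewrite exp_0; lra.
  - rewrite Rabs_mult.
    replace (- ((sin2_sum u k + Rsqr (sin (2 * PI * u / INR (S k)))) / 2))
      with (- (sin2_sum u k / 2) + - (Rsqr (sin (2 * PI * u / INR (S k))) / 2)) by field.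
    rewrite exp_plus.
    apply Rmult_le_compat; auto using Rabs_pos, Rabs_cos_le_exp.
Qed.

Lemma sin2_sum_mono (u : R) (a b : nat) : (a <= b)%nat -> sin2_sum u a <= sin2_sum u b.
Proof.
  induction 1 as [|b _ IH]; cbn [sin2_sum]; [lra|].
  pose proof (Rle_0_sqr (sin (2 * PI * u / INR (S b)))); lra.
Qed.

(** The blocks are disjoint and all terms are nonnegative, so one good term per block suffices. The
    sine is taken at [S n] because passing from [sin2_sum u n] to [sin2_sum u (S n)] adds that
    term. *)
Lemma sin2_sum_blocks (u v : R) (a w M : nat) :
  (forall i, (i < M)%nat -> exists n, (a + i * w <= n < a + S i * w)%nat /\
     v <= Rsqr (sin (2 * PI * u / INR (S n)))) ->
  INR M * v <= sin2_sum u (a + M * w).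
Proof.
  induction M as [|M IH]; intros H.
  - simpl INR. rewrite Rmult_0_l.
    apply (sin2_sum_mono u 0); lia.
  - destruct (H M) as [n [Hn Hv]]; [lia|].
    assert (IH' : INR M * v <= sin2_sum u (a + M * w)) by (apply IH; intros i Hi; apply H; lia).
    pose proof (sin2_sum_mono u (a + M * w) n) as H1.
    pose proof (sin2_sum_mono u (S n) (a + S M * w)) as H2.
    cbn [sin2_sum] in H2. rewrite S_INR.
    specialize (H1 ltac:(lia)). specialize (H2 ltac:(lia)). lra.
Qed.

(** * Low frequencies *)

(** More than [4u - 1] integers in [(4u, 8u]] contribute at least [1/2] each to the sine sum, so the
    exponent is below [1/4 - u]; the [1/4] pays for integer parts and is absorbed in the factor
    [2]. *)
Lemma prod_cos_le_low (u : R) (N : nat) :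
  0 <= u <= INR N / 8 -> Rabs (prod_cos u N) <= 2 * exp (- u).
Proof.
  intros [Hu HN].
  (* The [n] with [4u < n <= 8u] have [2 PI u / n] in [[PI/4, PI/2]]. *)
  pose proof PI_RGT_0 as HPI.
  destruct (nfloor_ex (4 * u)) as [a Ha]; [lra|].
  destruct (nfloor_ex (8 * u)) as [b Hb]; [lra|].
  assert (Hab : (a <= b)%nat).
  { apply INR_le. assert (INR a < INR (S b)); [rewrite S_INR; lra|].
    apply INR_lt in H. apply le_INR. lia. }
  assert (HbN : (b <= N)%nat) by (apply INR_le; lra).
  assert (Hs : INR (b - a) * (1 / 2) <= sin2_sum u N).
  { apply Rle_trans with (sin2_sum u (a + (b - a) * 1)).
    2: apply sin2_sum_mono; lia.
    apply sin2_sum_blocks. intros i Hi. exists (a + i)%nat. split; [lia|].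
    set (x := INR (S (a + i))).
    assert (Hx : 4 * u < x <= 8 * u).
    { unfold x. split.
      - assert (INR a <= INR (a + i)) by (apply le_INR; lia). rewrite S_INR; lra.
      - apply Rle_trans with (INR b); [apply le_INR; lia|lra]. }
    assert (Hx0 : 0 < x) by lra.
    assert (H1 : PI / 4 <= 2 * PI * u / x).
    { apply Rmult_le_reg_r with x; [lra|]. field_simplify; [|lra]. nra. }
    assert (H2 : 2 * PI * u / x <= PI / 2).
    { apply Rmult_le_reg_r with x; [lra|]. field_simplify; [|lra]. nra. }
    assert (H3 : sin (PI / 4) <= sin (2 * PI * u / x)) by (apply sin_incr_1; lra).
    rewrite sin_PI4 in H3.
    assert (H4 : 0 < sqrt 2) by (apply sqrt_lt_R0; lra).
    apply Rle_trans with (Rsqr (1 / sqrt 2)).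
    - unfold Rsqr. replace (1 / sqrt 2 * (1 / sqrt 2)) with (1 / (sqrt 2 * sqrt 2)) by (field; lra).
      rewrite sqrt_sqrt; lra.
    - apply Rsqr_incr_1; auto; [|apply Rle_trans with (1 / sqrt 2); auto];
        left; apply Rdiv_lt_0_compat; lra. }
  rewrite minus_INR in Hs by lia.
  eapply Rle_trans; [apply Rabs_prod_cos_le_exp|].
  apply Rle_trans with (exp (1 / 4 + - u)).
  - apply exp_mono. lra.
  - rewrite exp_plus. apply Rmult_le_compat_r; [left; apply exp_pos|].
    (* The square of [exp (1/2)] is at most [3], hence [exp (1/4) < exp (1/2) < 2]. *)
    assert (H1 : exp (1/4) < exp (1/2)) by (apply exp_increasing; lra).
    pose proof exp_le_3 as H3.
    replace 1 with (1/2 + 1/2) in H3 by field. rewrite exp_plus in H3.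
    pose proof (exp_pos (1/2)). nra.
Qed.

(** * Iterated differences of [2u/n] *)

(** A rising factorial with [k + 1] factors, from [n] to [n + k]. *)
Fixpoint rise (n k : nat) : R :=
  match k with
  | O => INR n
  | S j => rise n j * INR (n + S j)
  end.

(* [(-1)^k] times the [k]-th forward difference of [n |-> 2u/n]. *)
Definition recip_diff (u : R) (k n : nat) : R := 2 * u * INR (fact k) / rise n k.

Lemma rise_pos (n k : nat) : (0 < n)%nat -> 0 < rise n k.
Proof.
  intros Hn. induction k as [|k IH]; cbn [rise].
  - apply lt_0_INR; lia.
  - apply Rmult_lt_0_compat; auto. apply lt_0_INR; lia.
Qed.

Lemma rise_0_l (k : nat) : rise 0 k = 0.
Proof. induction k as [|k IH]; cbn [rise]; [reflexivity|rewrite IH; ring]. Qed.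

(** Both sides are the product of [n, ..., n + k + 1]. *)
Lemma rise_shift (n k : nat) : rise (S n) k * INR n = rise n k * INR (n + S k).
Proof.
  induction k as [|k IH]; cbn [rise].
  - replace (n + 1)%nat with (S n) by lia. ring.
  - replace (rise (S n) k * INR (S n + S k) * INR n)
      with ((rise (S n) k * INR n) * INR (S n + S k)) by ring.
    rewrite IH. replace (n + S (S k))%nat with (S n + S k)%nat by lia. ring.
Qed.

(** Over the common denominator [n ... (n+k+1)] the numerators differ by [(n+k+1) - n = k+1], which
    turns [k!] into [(k+1)!]. *)
Lemma recip_diff_step (u : R) (k n : nat) : (0 < n)%nat ->
  recip_diff u (S k) n = recip_diff u k n - recip_diff u k (S n).
Proof.
  intros Hn. unfold recip_diff. cbn [rise].
  pose proof (rise_shift n k) as Hs.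
  assert (H1 : 0 < INR n) by (apply lt_0_INR; lia).
  assert (H2 : 0 < INR (n + S k)) by (apply lt_0_INR; lia).
  pose proof (rise_pos n k Hn) as H3.
  pose proof (rise_pos (S n) k ltac:(lia)) as H4.
  assert (E : rise (S n) k = rise n k * INR (n + S k) / INR n) by (rewrite <- Hs; field; lra).
  rewrite E, fact_simpl, mult_INR, plus_INR.
  rewrite plus_INR in H2.
  field. lra.
Qed.

Lemma Rabs_sin_minus (a b : R) : Rabs (sin (a - b)) <= Rabs (sin a) + Rabs (sin b).
Proof.
  rewrite sin_minus. eapply Rle_trans; [apply Rabs_triang|].
  rewrite Rabs_Ropp, !Rabs_mult.
  assert (Hc : forall x, Rabs (cos x) <= 1) by (intro x; apply Rabs_le; apply COS_bound).
  pose proof (Hc a); pose proof (Hc b).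
  pose proof (Rabs_pos (sin a)); pose proof (Rabs_pos (sin b)).
  pose proof (Rabs_pos (cos a)); pose proof (Rabs_pos (cos b)). nra.
Qed.

(* [|sin (PI .)|] is subadditive, so this measures how far [recip_diff u k n]
   is from the integers without mentioning nearest integers. *)
Lemma sin_recip_diff (u v : R) (k n : nat) : (0 < n)%nat ->
  (forall j, (j <= k)%nat -> Rabs (sin (2 * PI * u / INR (n + j))) <= v) ->
  Rabs (sin (PI * recip_diff u k n)) <= 2 ^ k * v.
Proof.
  revert n. induction k as [|k IH]; intros n Hn H.
  - unfold recip_diff; cbn [rise fact INR pow].
    specialize (H O (le_n _)). rewrite Nat.add_0_r in H.
    replace (PI * (2 * u * 1 / INR n)) with (2 * PI * u / INR n).
    + lra.
    + field. apply not_0_INR; lia.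
  - rewrite recip_diff_step by assumption. rewrite Rmult_minus_distr_l.
    eapply Rle_trans; [apply Rabs_sin_minus|].
    assert (H1 : Rabs (sin (PI * recip_diff u k n)) <= 2 ^ k * v).
    { apply IH; auto. }
    assert (H2 : Rabs (sin (PI * recip_diff u k (S n))) <= 2 ^ k * v).
    { apply IH; [lia|]. intros j Hj.
      replace (S n + j)%nat with (n + S j)%nat by lia. apply H; lia. }
    simpl pow. lra.
Qed.

(** If all these sines were at most [2^{-k} / 2], whose square is the stated bound, then
    [sin (PI * recip_diff u k n)] would be at most [1/2]; but its argument lies in [[PI/4, PI/2]],
    where the sine is at least [1 / sqrt 2]. *)
Lemma exists_large_sin (u : R) (k n : nat) : (0 < n)%nat ->
  1 / 4 <= recip_diff u k n <= 1 / 2 ->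
  exists j, (j <= k)%nat /\ / 4 ^ k / 4 <= Rsqr (sin (2 * PI * u / INR (n + j))).
Proof.
  intros Hn HD. apply NNPP. intros Hno.
  pose proof PI_RGT_0 as HPI.
  assert (H2k : 0 < 2 ^ k) by (apply pow_lt; lra).
  assert (H : Rabs (sin (PI * recip_diff u k n)) <= 2 ^ k * (/ 2 ^ k / 2)).
  { apply sin_recip_diff; auto. intros j Hj.
    apply Rnot_lt_le. intros Hlt. apply Hno. exists j; split; auto.
    rewrite Rsqr_abs.
    replace (/ 4 ^ k / 4) with (Rsqr (/ 2 ^ k / 2)).
    - apply Rsqr_incr_1; [lra| |apply Rabs_pos].
      apply Rmult_le_pos; [left; apply Rinv_0_lt_compat; lra|lra].
    - replace 4 with (2 * 2) at 1 by ring. rewrite Rpow_mult_distr. unfold Rsqr. field. lra. }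
  replace (2 ^ k * (/ 2 ^ k / 2)) with (1 / 2) in H by (field; lra).
  assert (H3 : sin (PI / 4) <= sin (PI * recip_diff u k n)) by (apply sin_incr_1; nra).
  rewrite sin_PI4 in H3.
  assert (H4 : 1 / 2 < 1 / sqrt 2).
  { apply Rmult_lt_compat_l; [lra|]. apply Rinv_lt_contravar.
    - apply Rmult_lt_0_compat; [apply sqrt_lt_R0|]; lra.
    - rewrite <- (sqrt_square 2) at 2 by lra. apply sqrt_lt_1; lra. }
  pose proof (Rle_abs (sin (PI * recip_diff u k n))). lra.
Qed.

Lemma rise_le (n n' k : nat) : (n <= n')%nat -> rise n k <= rise n' k.
Proof.
  intros Hn.
  assert (H0 : forall a j, 0 <= rise a j).
  { intros a j. destruct a; [rewrite rise_0_l; lra|left; apply rise_pos; lia]. }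
  induction k as [|k IH]; cbn [rise].
  - apply le_INR; lia.
  - apply Rmult_le_compat; auto using pos_INR. apply le_INR; lia.
Qed.

(** Each of the [k + 1] factors grows by at most [1 + d/m <= exp (d/m)]. *)
Lemma rise_add_le (m d k : nat) : (0 < m)%nat ->
  rise (m + d) k <= rise m k * exp (INR (S k) * (INR d / INR m)).
Proof.
  intros Hm.
  assert (Hm0 : 0 < INR m) by (apply lt_0_INR; lia).
  assert (Hstep : forall j, INR (m + d + j) <= INR (m + j) * exp (INR d / INR m)).
  { intro j. rewrite !plus_INR.
    pose proof (exp_ineq1_le (INR d / INR m)) as He.
    pose proof (pos_INR d). pose proof (pos_INR j).
    assert (0 <= INR d / INR m) by (apply Rmult_le_pos; [|left; apply Rinv_0_lt_compat]; lra).
    apply Rle_trans with ((INR m + INR j) * (1 + INR d / INR m)).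
    - replace ((INR m + INR j) * (1 + INR d / INR m))
        with (INR m + INR j + INR d + INR j * (INR d / INR m)) by (field; lra). nra.
    - apply Rmult_le_compat_l; lra. }
  induction k as [|k IH]; cbn [rise].
  - specialize (Hstep O). rewrite !Nat.add_0_r in Hstep.
    simpl (INR 1). rewrite Rmult_1_l. exact Hstep.
  - rewrite (S_INR (S k)), Rmult_plus_distr_r, Rmult_1_l, exp_plus.
    apply Rle_trans with
      (rise m k * exp (INR (S k) * (INR d / INR m)) * (INR (m + S k) * exp (INR d / INR m))).
    + apply Rmult_le_compat; auto using pos_INR.
      left; apply rise_pos; lia.
    + right; ring.
Qed.

(** The [k]-th difference drops to at most [1/2] at [m + 1]. Over the next [M] blocks of length
    [k + 1] it loses at most a factor [exp (1/2) <= 2], hence stays in [[1/4, 1/2]], and each block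
    supplies a squared sine of size [4^{-k} / 4]. The two size conditions keep these blocks below
    [N]. *)
Lemma prod_cos_le_blocks (u : R) (k m M N : nat) :
  (2 * m <= N)%nat -> (2 * M * (S k * S k) <= m)%nat ->
  rise m k < 4 * u * INR (fact k) <= rise (S m) k ->
  Rabs (prod_cos u N) <= exp (- (INR M / (8 * 4 ^ k))).
Proof.
  intros HmN HMm [Hlo Hhi].
  assert (H4k : 0 < 4 ^ k) by (apply pow_lt; lra).
  assert (Hs : INR M * (/ 4 ^ k / 4) <= sin2_sum u N).
  { apply Rle_trans with (sin2_sum u (m + M * S k)).
    2: { apply sin2_sum_mono. nia. }
    apply sin2_sum_blocks. intros i Hi.
    set (d := (1 + i * S k)%nat).
    assert (Hm : (0 < m)%nat) by nia.
    assert (Hm0 : 0 < INR m) by (apply lt_0_INR; lia).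
    destruct (exists_large_sin u k (m + d)) as [j [Hj Hv]].
    - lia.
    - assert (Hp : 0 < rise (m + d) k) by (apply rise_pos; lia).
      unfold recip_diff. split.
      + apply Rmult_le_reg_r with (rise (m + d) k); auto.
        replace (2 * u * INR (fact k) / rise (m + d) k * rise (m + d) k)
          with (2 * u * INR (fact k)) by (field; lra).
        pose proof (rise_add_le m d k Hm) as H1.
        pose proof (rise_pos m k Hm) as H2.
        (* For [i < M] the offset satisfies [(k+1) d <= M (k+1)^2 <= m/2]. *)
        assert (H3 : INR (S k) * (INR d / INR m) <= 1 / 2).
        { apply Rmult_le_reg_r with (2 * INR m); [lra|].
          replace (INR (S k) * (INR d / INR m) * (2 * INR m))
            with (INR (2 * (S k * d))) by (rewrite !mult_INR; simpl (INR 2); field; lra).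
          replace (1 / 2 * (2 * INR m)) with (INR m) by field.
          apply le_INR. unfold d. nia. }
        assert (H4 : exp (INR (S k) * (INR d / INR m)) <= 2).
        { apply Rle_trans with (exp (1 / 2)).
          - apply exp_mono, H3.
          - pose proof exp_le_3 as H5. replace 1 with (1/2 + 1/2) in H5 by field.
            rewrite exp_plus in H5. pose proof (exp_pos (1/2)). nra. }
        nra.
      + apply Rmult_le_reg_r with (rise (m + d) k); auto.
        replace (2 * u * INR (fact k) / rise (m + d) k * rise (m + d) k)
          with (2 * u * INR (fact k)) by (field; lra).
        pose proof (rise_le (S m) (m + d) k ltac:(lia)). lra.
    - exists (m + i * S k + j)%nat. split; [nia|].
      replace (S (m + i * S k + j)) with (m + d + j)%nat by (unfold d; lia). exact Hv. }
  eapply Rle_trans; [apply Rabs_prod_cos_le_exp|].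
  apply exp_mono.
  replace (INR M / (8 * 4 ^ k)) with (INR M * (/ 4 ^ k / 4) / 2) by (field; lra). lra.
Qed.

(** * Choice of the order of difference, and high frequencies *)

Lemma pow_eq_exp (x : R) (n : nat) : 0 < x -> x ^ n = exp (INR n * ln x).
Proof. intros Hx. rewrite <- Rpower_pow by assumption. reflexivity. Qed.

Lemma least_nat (P : nat -> Prop) (n : nat) : P n ->
  exists k, (k <= n)%nat /\ P k /\ forall j, (j < k)%nat -> ~ P j.
Proof.
  induction n as [n IH] using (well_founded_induction lt_wf). intros Hn.
  destruct (classic (exists j, (j < n)%nat /\ P j)) as [[j [Hj HP]]|H].
  - destruct (IH j Hj HP) as [k [Hk H]]. exists k; split; [lia|assumption].
  - exists n. repeat split; auto. intros j Hj HP. apply H; eauto.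
Qed.

Lemma pow_le_rise (n k : nat) : INR n ^ S k <= rise n k.
Proof.
  induction k as [|k IH]; [simpl; lra|].
  cbn [rise]. rewrite <- tech_pow_Rmult, Rmult_comm.
  apply Rmult_le_compat; auto using pos_INR, pow_le. apply le_INR; lia.
Qed.

Lemma rise_le_pow (n k : nat) : rise n k <= INR (n + k) ^ S k.
Proof.
  (* The base [n + k] stays fixed, so the induction on [j] claims the bound only up to [k]. *)
  assert (H : forall j, rise n j <= INR (n + k) ^ S j \/ (k < j)%nat).
  { induction j as [|j [IH|IH]]; [left|..|right; lia].
    - simpl. rewrite Rmult_1_r. apply le_INR; lia.
    - destruct (le_lt_dec (S j) k) as [Hj|Hj]; [left|right; lia].
      cbn [rise]. rewrite <- tech_pow_Rmult, Rmult_comm.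
      apply Rmult_le_compat; auto using pos_INR; [|apply le_INR; lia].
      apply Rle_trans with (INR n ^ S j); [apply pow_le, pos_INR|apply pow_le_rise]. }
  destruct (H k) as [Hk|Hk]; [exact Hk|lia].
Qed.

Lemma fact_le_pow (k : nat) : INR (fact k) <= INR k ^ k.
Proof.
  assert (H : forall j, (j <= k)%nat -> INR (fact j) <= INR k ^ j).
  { induction j as [|j IH]; intros Hj; [simpl; lra|].
    rewrite fact_simpl, mult_INR, <- tech_pow_Rmult.
    apply Rmult_le_compat; auto using pos_INR; [apply le_INR; lia|apply IH; lia]. }
  auto.
Qed.

(** Here [k] is the least order whose difference at [N / 2] is at most [1/2], and [m + 1] the least
    point where that order achieves this. Minimality of [k] makes the previous order fail at
    [N / 2]; comparing the two inequalities gives the last conclusion, which says that [m] is nearly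
    of size [N^{k/(k+1)}]. *)
Lemma exists_diff_order (u : R) (N K : nat) :
  INR N / 8 < u -> 4 * u * INR (fact K) <= rise (N / 2) K ->
  exists k m, (1 <= k <= K)%nat /\ (2 * m <= N)%nat /\
    rise m k < 4 * u * INR (fact k) <= rise (S m) k /\
    INR (N / 2) ^ k <= INR (S m + k) ^ S k.
Proof.
  intros Hu HK. set (H := (N / 2)%nat) in *.
  assert (HH : (2 * H <= N)%nat) by (unfold H; pose proof (Nat.div_mod_eq N 2); lia).
  assert (HHr : 2 * INR H <= INR N) by (apply le_INR in HH; rewrite mult_INR in HH; exact HH).
  pose proof (pos_INR N) as HN0.
  destruct (least_nat (fun k => 4 * u * INR (fact k) <= rise H k) K HK) as [k [Hk [HPk Hmin]]].
  destruct k as [|k].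
  (* Order [0] would require [4u <= N/2], against [u > N/8]. *)
  { exfalso. simpl in HPk. lra. }
  destruct (least_nat (fun n => 4 * u * INR (fact (S k)) <= rise n (S k)) H HPk)
    as [n [Hn [HPn Hnmin]]].
  assert (Hf : 0 < INR (fact (S k))) by apply INR_fact_lt_0.
  destruct n as [|m].
  { exfalso. rewrite rise_0_l in HPn. nra. }
  exists (S k), m. split; [lia|]. split; [lia|]. split.
  - split; [|exact HPn]. apply Rnot_le_lt, Hnmin. lia.
  - specialize (Hmin k ltac:(lia)). apply Rnot_le_lt in Hmin.
    apply Rle_trans with (rise H k); [apply pow_le_rise|].
    apply Rle_trans with (rise (S m) (S k)); [|apply rise_le_pow].
    apply Rle_trans with (4 * u * INR (fact (S k))); [|exact HPn].
    apply Rle_trans with (4 * u * INR (fact k)); [lra|].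
    apply Rmult_le_compat_l; [lra|]. apply le_INR, fact_le; lia.
Qed.

(** [exp (a L)] is the sixth power of [exp (a L / 6) >= a L / 6], and [L^6] beats any multiple of
    [L^5]. The fifth power covers every polynomial loss met below. *)
Lemma exp_dominates (a A : R) : 0 < a ->
  exists L0, forall L, L0 <= L -> A * L ^ 5 <= exp (a * L).
Proof.
  intros Ha. assert (Hc : 0 < (a / 6) ^ 6) by (apply pow_lt; lra).
  exists (Rmax 1 (A / (a / 6) ^ 6)). intros L HL.
  assert (H1 : 1 <= L) by (eapply Rle_trans; [apply Rmax_l|exact HL]).
  assert (H2 : A / (a / 6) ^ 6 <= L) by (eapply Rle_trans; [apply Rmax_r|exact HL]).
  assert (H3 : A <= (a / 6) ^ 6 * L).
  { apply Rmult_le_compat_l with (r := (a / 6) ^ 6) in H2; [|lra].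
    replace ((a / 6) ^ 6 * (A / (a / 6) ^ 6)) with A in H2 by (field; lra). exact H2. }
  apply Rle_trans with ((a / 6 * L) ^ 6).
  - rewrite Rpow_mult_distr. change (L ^ 6) with (L * L ^ 5). rewrite <- Rmult_assoc.
    apply Rmult_le_compat_r; [apply pow_le; lra|exact H3].
  - replace (a * L) with (INR 6 * (a / 6 * L)) by (simpl; field).
    apply Rle_trans with (exp (a / 6 * L) ^ 6).
    + apply pow_incr. split; [nra|]. pose proof (exp_ineq1_le (a / 6 * L)); lra.
    + rewrite pow_eq_exp by apply exp_pos. rewrite ln_exp. lra.
Qed.

Lemma ln_eventually (L0 : R) :
  exists N0 : nat, forall N, (N0 <= N)%nat -> (3 <= N)%nat /\ L0 <= ln (INR N).
Proof.
  destruct (nfloor_ex (exp L0)) as [n Hn]; [left; apply exp_pos|].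
  exists (n + 3)%nat. intros N HN. split; [lia|].
  apply le_INR in HN. rewrite plus_INR in HN. simpl (INR 3) in HN.
  rewrite <- (ln_exp L0). left. apply ln_increasing; [apply exp_pos|lra].
Qed.

Lemma ln_le_compat (x y : R) : 0 < x -> x <= y -> ln x <= ln y.
Proof. intros Hx [H|H]; [left; apply ln_increasing; auto|right; f_equal; auto]. Qed.

Lemma ln_4_bounds : 1 <= ln 4 <= 2.
Proof.
  pose proof exp_le_3 as H. pose proof (exp_ineq1_le 1) as H'.
  split.
  - rewrite <- (ln_exp 1). apply ln_le_compat; [apply exp_pos|lra].
  - rewrite <- (ln_exp 2). apply ln_le_compat; [lra|].
    replace 2 with (1 + 1) at 1 by ring. rewrite exp_plus. nra.
Qed.

(* The constant [1 / ln 4]: there are about [N / k^2] blocks, each contributing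
   [4^{-k}] with [k] about [C ln N], so the total is a positive power of [N]
   exactly when [C ln 4 < 1]. *)
Lemma prod_cos_le_high (C A : R) : 0 < C < 1 / ln 4 -> 0 <= A ->
  exists N0 : nat, forall N, (N0 <= N)%nat -> forall u,
    INR N / 8 < u <= exp (C * ln (INR N) ^ 2) ->
    Rabs (prod_cos u N) <= exp (- (A * ln (INR N) ^ 2)).
Proof.
  intros [HC0 HC] HA.
  pose proof ln_4_bounds as [Hl1 Hl2].
  assert (HC1 : C * ln 4 < 1).
  { apply Rmult_lt_compat_r with (r := ln 4) in HC; [|lra].
    replace (1 / ln 4 * ln 4) with 1 in HC by (field; lra). exact HC. }
  (* The order of difference will be at most about [kap * L]; [kap > C] makes that order sufficient,
     and [kap * ln 4 < 1] keeps [4^k] below a power of [N] smaller than one. *)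
  set (kap := (C + 1 / ln 4) / 2).
  assert (Hkl : kap * ln 4 = (C * ln 4 + 1) / 2) by (unfold kap; field; lra).
  assert (HkC : C < kap) by (unfold kap; lra).
  assert (Hk1 : kap < 1) by nra.
  (* The power of [N] to be saved. The bound [1/8] serves small [k]; for large [k], half of the room
     [1 - kap * ln 4] is kept and the other half absorbs constants. *)
  set (th := Rmin (1 / 8) ((1 - kap * ln 4) / 2)).
  assert (Hth0 : 0 < th) by (apply Rmin_pos; lra).
  assert (Hth1 : th <= 1 / 8) by apply Rmin_l.
  assert (Hth2 : 2 * th <= 1 - kap * ln 4).
  { assert (th <= (1 - kap * ln 4) / 2) by apply Rmin_r. lra. }
  (* Of the gap [4 sg] between [C] and [kap], two quarters pay for [K!] and two for the loss from
     [N] to [N / 2] and constants. *)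
  set (sg := (kap - C) / 4).
  assert (Hsg : 0 < sg) by (unfold sg; lra).
  destruct (exp_dominates sg 2 Hsg) as [L1 HL1].
  destruct (exp_dominates th (18 * (8 * A + 2)) Hth0) as [L2 HL2].
  destruct (ln_eventually (Rmax 8 (Rmax L1 (Rmax L2 (Rmax (2 / sg) (14 / th)))))) as [N0 HN0].
  exists N0. intros N HN u [Hu1 Hu2].
  destruct (HN0 N HN) as [HN3 HL]. clear HN0.
  set (L := ln (INR N)) in *.
  assert (HL8 : 8 <= L) by (eapply Rle_trans; [|exact HL]; apply Rmax_l).
  assert (HLr := Rle_trans _ _ _ (Rmax_r _ _) HL). clear HL.
  specialize (HL1 L (Rle_trans _ _ _ (Rmax_l _ _) HLr)).
  apply (Rle_trans _ _ _ (Rmax_r _ _)) in HLr.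
  specialize (HL2 L (Rle_trans _ _ _ (Rmax_l _ _) HLr)).
  apply (Rle_trans _ _ _ (Rmax_r _ _)) in HLr.
  assert (HLs := Rle_trans _ _ _ (Rmax_l _ _) HLr).
  assert (HLt := Rle_trans _ _ _ (Rmax_r _ _) HLr). clear HLr.
  assert (HLs' : 2 <= sg * L).
  { apply Rmult_le_compat_l with (r := sg) in HLs; [|lra].
    replace (sg * (2 / sg)) with 2 in HLs by (field; lra). exact HLs. }
  assert (HLt' : 14 <= th * L).
  { apply Rmult_le_compat_l with (r := th) in HLt; [|lra].
    replace (th * (14 / th)) with 14 in HLt by (field; lra). exact HLt. }
  clear HLs HLt.
  assert (HL5 : forall j, 1 <= L ^ j) by (intro j; apply pow_R1_Rle; lra).
  assert (HL1' : 2 * L <= exp (sg * L)).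
  { pose proof (HL5 4%nat). eapply Rle_trans; [|exact HL1].
    change (L ^ 5) with (L * L ^ 4). nra. }
  assert (HL2' : 18 * (8 * A + 2) * L ^ 4 <= exp (th * L)).
  { eapply Rle_trans; [|exact HL2]. apply Rmult_le_compat_l; [lra|].
    change (L ^ 5) with (L * L ^ 4). pose proof (HL5 4%nat). nra. }
  clear HL1 HL2.
  set (H := (N / 2)%nat).
  assert (HH1 : (1 <= H)%nat) by (apply (Nat.div_le_lower_bound N 2 1); lia).
  assert (HHN : (N <= 3 * H)%nat).
  { pose proof (Nat.div_mod_eq N 2). pose proof (Nat.mod_upper_bound N 2). fold H in H0. lia. }
  assert (HHN' : (H <= N)%nat) by (apply Nat.Div0.div_le_upper_bound; lia).
  assert (HN0 : 0 < INR N) by (apply lt_0_INR; lia).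
  assert (HH0 : 0 < INR H) by (apply lt_0_INR; lia).
  assert (HlnH : L - 2 <= ln (INR H) <= L).
  { split; [|apply ln_le_compat; [|apply le_INR]; auto].
    assert (L <= ln (4 * INR H)).
    { apply ln_le_compat; auto. apply le_INR in HHN. rewrite mult_INR in HHN.
      simpl (INR 3) in HHN. lra. }
    rewrite ln_mult in H0 by lra. lra. }
  destruct (nfloor_ex (kap * L)) as [K' HK']; [nra|].
  set (K := S K').
  assert (HK : kap * L <= INR K <= kap * L + 1) by (unfold K; rewrite S_INR; lra).
  assert (HK2 : INR K <= 2 * L) by nra.
  assert (HKpos : 0 < INR K) by nra.
  destruct (exists_diff_order u N K Hu1) as [k [m [Hk [HmN [Hm HQ]]]]].
  (* Order [K] is large enough: [4 u K!] is at most [4 exp (C L^2) K^K] with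
     [K <= 2L <= exp (sg * L)], while the rising factorial is at least [(N/2)^{K+1}]. *)
  { fold H. eapply Rle_trans; [|apply pow_le_rise].
    apply Rle_trans with (exp (ln 4) * exp (C * L ^ 2) * exp (sg * L * (2 * L))).
    - rewrite exp_ln by lra. apply Rmult_le_compat; [lra|apply pos_INR| |].
      + apply Rmult_le_compat_l; lra.
      + eapply Rle_trans; [apply fact_le_pow|].
        rewrite pow_eq_exp by assumption. apply exp_mono.
        assert (ln (INR K) <= sg * L).
        { rewrite <- (ln_exp (sg * L)). apply ln_le_compat; lra. }
        apply Rle_trans with (INR K * (sg * L)); [apply Rmult_le_compat_l; lra|].
        rewrite (Rmult_comm (INR K)). apply Rmult_le_compat_l; nra.
    - rewrite <- !exp_plus, (pow_eq_exp (INR H)) by assumption. apply exp_mono.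
      apply Rle_trans with (kap * L * (L - 2)).
      + assert (C = kap - 4 * sg) by (unfold sg; field).
        rewrite H0.
        assert (2 * L <= sg * L * L) by (apply Rmult_le_compat_r; lra).
        assert (kap * L <= 1 * L) by (apply Rmult_le_compat_r; lra).
        simpl pow. lra.
      + apply Rmult_le_compat; [nra|lra| |lra]. rewrite S_INR; lra. }
  fold H in HQ. set (Q := INR (S m + k)) in *.
  assert (HQ0 : 0 < Q) by (apply lt_0_INR; lia).
  assert (Hk0 : 1 <= INR k) by (apply (le_INR 1); lia).
  assert (HkK : INR k <= kap * L + 1).
  { apply Rle_trans with (INR K); [apply le_INR; lia|lra]. }
  assert (HlnQ : INR k * ln (INR H) <= (INR k + 1) * ln Q).
  { rewrite <- S_INR, <- (ln_pow (INR H) k HH0), <- (ln_pow Q (S k) HQ0). apply ln_le_compat; auto using pow_lt. }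
  (* For [k <= L/10], [Q >= sqrt H] already suffices, since [4^k] costs at most [L/5] in the
     exponent. Otherwise [ln H <= 10 (k+1)], so [ln Q >= ln H - 10]; the constants [10 + 2 + 2]
     explain the threshold [14 <= th * L]. *)
  assert (HQ1 : th * L <= ln Q - INR k * ln 4).
  { destruct (Rle_lt_dec (INR k) (L / 10)) as [Hs|Hb].
    - assert (1 / 2 * ln (INR H) <= ln Q).
      { apply Rmult_le_reg_l with (INR k + 1); [lra|].
        assert ((INR k + 1) / 2 * ln (INR H) <= INR k * ln (INR H))
          by (apply Rmult_le_compat_r; lra).
        lra. }
      assert (INR k * ln 4 <= L / 10 * 2) by (apply Rmult_le_compat; lra).
      assert (th * L <= 1 / 8 * L) by (apply Rmult_le_compat_r; lra).
      lra.
    - assert (ln (INR H) - 10 <= ln Q).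
      { apply Rmult_le_reg_l with (INR k + 1); lra. }
      assert (INR k * ln 4 <= (kap * L + 1) * ln 4) by (apply Rmult_le_compat_r; lra).
      assert (kap * ln 4 * L <= (1 - 2 * th) * L) by (apply Rmult_le_compat_r; lra).
      lra. }
  assert (HQ2 : 4 ^ k * exp (th * L) <= Q).
  { rewrite (pow_eq_exp 4) by lra. rewrite <- exp_plus.
    rewrite <- (exp_ln Q) by assumption. apply exp_mono. lra. }
  (* The largest number of blocks that [prod_cos_le_blocks] permits. *)
  set (M := (m / (2 * (S k * S k)))%nat).
  eapply Rle_trans; [apply (prod_cos_le_blocks u k m M N); auto|].
  { unfold M. pose proof (Nat.Div0.mul_div_le m (2 * (S k * S k))). lia. }
  apply exp_mono, Ropp_le_contravar.
  assert (HM : INR m <= 2 * ((INR k + 1) * (INR k + 1)) * (INR M + 1)).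
  { assert (Hn : (m <= 2 * (S k * S k) * (M + 1))%nat).
    { unfold M. pose proof (Nat.mul_succ_div_gt m (2 * (S k * S k)) ltac:(lia)). lia. }
    apply le_INR in Hn. rewrite !mult_INR, plus_INR, !S_INR in Hn. simpl (INR 0) in Hn.
    replace (0 + 1) with 1 in Hn by ring. lra. }
  assert (HQm : INR m = Q - (INR k + 1)).
  { unfold Q. rewrite plus_INR, S_INR. ring. }
  set (a := 4 ^ k) in *. assert (Ha : 1 <= a) by (apply pow_R1_Rle; lra).
  set (k1 := INR k + 1) in *.
  assert (Hk1' : 2 <= k1 <= 3 * L) by (unfold k1; nra).
  apply Rmult_le_reg_r with (8 * a); [lra|].
  replace (INR M / (8 * a) * (8 * a)) with (INR M) by (field; lra).
  apply Rmult_le_reg_r with (2 * (k1 * k1)); [nra|].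
  assert (E1 : a * (18 * (8 * A + 2) * L ^ 4) <= Q) by nra.
  assert (E2 : k1 * k1 <= 9 * L ^ 2) by (simpl pow; nra).
  (* The [+ 2] covers the rounding in [M] and the [k + 1] by which [m] falls short of [Q]; [18 L^2]
     bounds [2 (k+1)^2]. *)
  assert (E3 : (8 * A * a * L ^ 2 + 2) * (2 * (k1 * k1)) <= Q).
  { apply Rle_trans with ((8 * A * a * L ^ 2 + 2) * (18 * L ^ 2)).
    - apply Rmult_le_compat_l; [|lra].
      pose proof (pow2_ge_0 L). assert (0 <= A * a) by nra. nra.
    - eapply Rle_trans; [|exact E1].
      replace (L ^ 4) with (L ^ 2 * L ^ 2) by ring.
      pose proof (HL5 2%nat) as HLL. set (LL := L ^ 2) in *.
      assert (0 <= (a * LL - 1) * LL).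
      { apply Rmult_le_pos; [nra|lra]. }
      nra. }
  nra.
Qed.

(** * Convergence and continuity of the infinite product *)

Lemma Rabs_sin_le (y : R) : Rabs (sin y) <= Rabs y.
Proof.
  assert (H : forall z, 0 <= z -> Rabs (sin z) <= z).
  { intros z Hz. destruct (Rle_lt_dec 1 z) as [H1|H1].
    - apply Rle_trans with 1; [|exact H1]. apply Rabs_le, SIN_bound.
    - pose proof PI2_1. destruct Hz as [Hz|<-]; [|rewrite sin_0, Rabs_R0; lra].
      rewrite Rabs_pos_eq; [left; apply sin_lt_x; auto|].
      apply sin_ge_0; lra. }
  destruct (Rle_lt_dec 0 y) as [Hy|Hy].
  - rewrite (Rabs_pos_eq y) by assumption. auto.
  - rewrite (Rabs_left y) by assumption. rewrite <- Rabs_Ropp, <- sin_neg. apply H; lra.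
Qed.

Lemma Rabs_cos_minus_le (a b : R) : Rabs (cos a - cos b) <= Rabs (a - b).
Proof.
  rewrite form2, !Rabs_mult.
  replace (Rabs (-2)) with 2 by (rewrite Rabs_left; lra).
  pose proof (Rabs_sin_le ((a - b) / 2)) as H1.
  assert (H2 : Rabs (sin ((a + b) / 2)) <= 1) by apply Rabs_le, SIN_bound.
  unfold Rdiv in H1 at 2. rewrite Rabs_mult, (Rabs_pos_eq (/ 2)) in H1 by lra.
  pose proof (Rabs_pos (sin ((a - b) / 2))). pose proof (Rabs_pos (sin ((a + b) / 2))).
  pose proof (Rabs_pos (a - b)). nra.
Qed.

Lemma one_minus_cos_le (x : R) : Rabs (cos x - 1) <= x ^ 2 / 2.
Proof.
  replace x with (2 * (x / 2)) at 1 by field. rewrite cos_2a_sin.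
  replace (1 - 2 * sin (x / 2) * sin (x / 2) - 1) with (- (2 * Rsqr (sin (x / 2))))
    by (unfold Rsqr; ring).
  rewrite Rabs_Ropp, Rabs_pos_eq.
  - rewrite Rsqr_abs. pose proof (Rabs_sin_le (x / 2)) as H.
    apply Rsqr_incr_1 in H; auto using Rabs_pos.
    rewrite <- (Rsqr_abs (x / 2)) in H. unfold Rsqr in H at 2. lra.
  - pose proof (Rle_0_sqr (sin (x / 2))). lra.
Qed.

Lemma Rabs_prod_cos_le_1 (u : R) (N : nat) : Rabs (prod_cos u N) <= 1.
Proof.
  eapply Rle_trans; [apply Rabs_prod_cos_le_exp|].
  rewrite <- exp_0. apply exp_mono.
  pose proof (sin2_sum_mono u 0 N ltac:(lia)) as H. simpl in H. lra.
Qed.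

(** The factor of index [M + 1] differs from [1] by at most [2 PI^2 u^2 / (M+1)^2], hence by at most
    [32 u^2 / (M (M+1))], and this telescopes. *)
Lemma prod_cos_cauchy (u : R) (N M : nat) : (1 <= N <= M)%nat ->
  Rabs (prod_cos u M - prod_cos u N) <= 32 * u ^ 2 * (/ INR N - / INR M).
Proof.
  intros [HN HM]. induction HM as [|M HM IH].
  - rewrite !Rminus_diag, Rabs_R0. lra.
  - cbn [prod_cos]. set (c := cos (2 * PI * u / INR (S M))).
    replace (prod_cos u M * c - prod_cos u N)
      with (prod_cos u M * (c - 1) + (prod_cos u M - prod_cos u N)) by ring.
    eapply Rle_trans; [apply Rabs_triang|].
    assert (HM0 : 0 < INR M) by (apply lt_0_INR; lia).
    assert (Hc : Rabs (prod_cos u M * (c - 1)) <= 32 * u ^ 2 * (/ INR M - / INR (S M))).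
    { rewrite Rabs_mult. pose proof (Rabs_prod_cos_le_1 u M).
      apply Rle_trans with (1 * ((2 * PI * u / INR (S M)) ^ 2 / 2)).
      - apply Rmult_le_compat; auto using Rabs_pos. apply one_minus_cos_le.
      - rewrite S_INR. set (m := INR M) in *.
        replace (1 * ((2 * PI * u / (m + 1)) ^ 2 / 2))
          with (2 * PI ^ 2 * (u ^ 2 * (/ (m + 1) * / (m + 1)))) by (field; lra).
        replace (32 * u ^ 2 * (/ m - / (m + 1)))
          with (32 * (u ^ 2 * (/ m * / (m + 1)))) by (field; lra).
        assert (Hpi : 2 * PI ^ 2 <= 32) by (pose proof PI_4; pose proof PI_RGT_0; simpl; nra).
        assert (H1 : 0 < / (m + 1)) by (apply Rinv_0_lt_compat; lra).
        assert (H2 : / (m + 1) <= / m) by (apply Rinv_le_contravar; lra).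
        pose proof (pow2_ge_0 u).
        apply Rmult_le_compat; [pose proof (pow2_ge_0 PI); lra| |exact Hpi|].
        + apply Rmult_le_pos; nra.
        + apply Rmult_le_compat_l; [assumption|]. apply Rmult_le_compat_r; lra. }
    lra.
Qed.

Lemma prod_cos_dist_le (u : R) (N M : nat) : (1 <= N)%nat -> (N <= M)%nat ->
  Rabs (prod_cos u M - prod_cos u N) <= 32 * u ^ 2 / INR N.
Proof.
  intros HN HM. eapply Rle_trans; [apply prod_cos_cauchy; auto|].
  unfold Rdiv. apply Rmult_le_compat_l; [pose proof (pow2_ge_0 u); lra|].
  assert (0 < / INR M) by (apply Rinv_0_lt_compat, lt_0_INR; lia). lra.
Qed.

Lemma Rinv_INR_eventually (A eps : R) : 0 < eps ->
  exists N0 : nat, (1 <= N0)%nat /\ forall N, (N0 <= N)%nat -> A / INR N < eps.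
Proof.
  intros He. destruct (nfloor_ex (Rmax 0 (A / eps))) as [n Hn]; [apply Rmax_l|].
  exists (S n). split; [lia|]. intros N HN.
  apply le_INR in HN. rewrite S_INR in HN. pose proof (pos_INR n) as Hn0.
  assert (H : A / eps < INR N) by (pose proof (Rmax_r 0 (A / eps)); lra).
  apply Rmult_lt_reg_r with (INR N); [lra|].
  replace (A / INR N * INR N) with A by (field; lra).
  apply Rmult_lt_compat_r with (r := eps) in H; [|lra].
  replace (A / eps * eps) with A in H by (field; lra). lra.
Qed.

(** [infprod] is defined by the total operators [Lim_seq] and [real]; the Cauchy estimate shows that
    it is a genuine finite limit. *)
Lemma is_lim_seq_infprod (u : R) : is_lim_seq (prod_cos u) (infprod u).
Proof.
  apply Lim_seq_correct', ex_lim_seq_cauchy_corr. intros eps.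
  destruct (Rinv_INR_eventually (32 * u ^ 2) (eps / 2)) as [N [HN1 HN]].
  { destruct eps; simpl; lra. }
  exists N. intros n m Hn Hm.
  pose proof (prod_cos_dist_le u N n HN1 Hn).
  pose proof (prod_cos_dist_le u N m HN1 Hm).
  specialize (HN N (le_n _)).
  replace (prod_cos u n - prod_cos u m)
    with ((prod_cos u n - prod_cos u N) - (prod_cos u m - prod_cos u N)) by ring.
  eapply Rle_lt_trans; [apply Rabs_triang|]. rewrite Rabs_Ropp. lra.
Qed.

Lemma infprod_approx (u : R) (N : nat) : (1 <= N)%nat ->
  Rabs (infprod u - prod_cos u N) <= 32 * u ^ 2 / INR N.
Proof.
  intros HN.
  assert (H : Rbar_le (Rbar_abs (Finite (infprod u - prod_cos u N))) (32 * u ^ 2 / INR N)).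
  { apply (is_lim_seq_le_loc (fun n => Rabs (prod_cos u n - prod_cos u N))
      (fun _ => 32 * u ^ 2 / INR N)).
    - exists N. intros n Hn. apply prod_cos_dist_le; auto.
    - apply is_lim_seq_abs. apply is_lim_seq_minus'; [apply is_lim_seq_infprod|].
      apply is_lim_seq_const.
    - apply is_lim_seq_const. }
  exact H.
Qed.

(** For fixed [u] the condition [u <= N/8] holds for all large [N], so the low-frequency bound
    passes to the limit. *)
Lemma infprod_le_exp (u : R) : 0 <= u -> Rabs (infprod u) <= 2 * exp (- u).
Proof.
  intros Hu.
  assert (H : Rbar_le (Rbar_abs (Finite (infprod u))) (2 * exp (- u))).
  { apply (is_lim_seq_le_loc (fun n => Rabs (prod_cos u n)) (fun _ => 2 * exp (- u))).
    - destruct (nfloor_ex (8 * u)) as [N HN]; [lra|].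
      exists (S N). intros n Hn. apply prod_cos_le_low.
      apply le_INR in Hn. rewrite S_INR in Hn. lra.
    - apply is_lim_seq_abs, is_lim_seq_infprod.
    - apply is_lim_seq_const. }
  exact H.
Qed.

Lemma continuous_prod_cos (N : nat) (u : R) : continuous (fun v => prod_cos v N) u.
Proof.
  induction N as [|N IH]; cbn [prod_cos].
  - apply continuous_const.
  - apply (continuous_mult (fun v => prod_cos v N)); auto.
    apply continuous_cos_comp.
    apply (ex_derive_continuous (fun v : R => 2 * PI * v / INR (S N))). auto_derive; auto.
Qed.

(** The partial products are continuous and converge uniformly on the unit neighbourhood of [u]. *)
Lemma continuous_infprod (u : R) : continuous infprod u.
Proof.
  apply filterlim_locally. intros eps.
  assert (Heps : 0 < eps) by apply cond_pos.
  destruct (Rinv_INR_eventually (32 * (Rabs u + 1) ^ 2) (eps / 3)) as [N [HN1 HN]]; [lra|].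
  specialize (HN N (le_n _)).
  assert (HN0 : 0 < INR N) by (apply lt_0_INR; lia).
  assert (Happ : forall v, Rabs (v - u) < 1 -> Rabs (infprod v - prod_cos v N) < eps / 3).
  { intros v Hv. eapply Rle_lt_trans; [apply infprod_approx; auto|].
    eapply Rle_lt_trans; [|exact HN]. unfold Rdiv. apply Rmult_le_compat_r.
    - left; apply Rinv_0_lt_compat; auto.
    - apply Rmult_le_compat_l; [lra|]. rewrite <- (pow2_abs v).
      apply pow_incr. split; [apply Rabs_pos|].
      replace v with (u + (v - u)) by ring. eapply Rle_trans; [apply Rabs_triang|]. lra. }
  pose proof (continuous_prod_cos N u) as Hc.
  apply filterlim_locally with (eps := mkposreal (eps / 3) ltac:(lra)) in Hc.
  assert (H1 : locally u (fun v => Rabs (v - u) < 1)) by (exists (mkposreal 1 Rlt_0_1); auto).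
  generalize (filter_and _ _ Hc H1). apply filter_imp. intros v [Hb Hv].
  change (Rabs (prod_cos v N - prod_cos u N) < eps / 3) in Hb.
  change (Rabs (infprod v - infprod u) < eps).
  pose proof (Happ v Hv) as A1.
  assert (A2 : Rabs (infprod u - prod_cos u N) < eps / 3).
  { apply Happ. rewrite Rminus_diag, Rabs_R0; lra. }
  replace (infprod v - infprod u) with
    ((infprod v - prod_cos v N) + (prod_cos v N - prod_cos u N) - (infprod u - prod_cos u N)) by ring.
  eapply Rle_lt_trans; [apply Rabs_triang|]. rewrite Rabs_Ropp.
  pose proof (Rabs_triang (infprod v - prod_cos v N) (prod_cos v N - prod_cos u N)). lra.
Qed.

(** * The density [g]: convergence, size and regularity *)

Lemma continuous_cos_freq (x u : R) : continuous (fun v => cos (2 * PI * v * x)) u.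
Proof.
  apply continuous_cos_comp.
  apply (ex_derive_continuous (fun v : R => 2 * PI * v * x)). auto_derive; auto.
Qed.

Lemma ex_RInt_g_integrand (x a b : R) : ex_RInt (fun u => cos (2 * PI * u * x) * infprod u) a b.
Proof.
  apply (@ex_RInt_continuous R_CompleteNormedModule). intros z _.
  apply (continuous_mult (fun u => cos (2 * PI * u * x)) infprod);
    [apply continuous_cos_freq|apply continuous_infprod].
Qed.

Lemma is_RInt_exp_majorant (c d a b : R) :
  is_RInt (fun u => c * exp (- u) + d) a b (c * (exp (- a) - exp (- b)) + d * (b - a)).
Proof.
  replace (c * (exp (- a) - exp (- b)) + d * (b - a))
    with (minus (- c * exp (- b) + d * b) (- c * exp (- a) + d * a))
    by (unfold minus, plus, opp; simpl; ring).
  apply (is_RInt_derive (fun u => - c * exp (- u) + d * u)).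
  - intros u _. auto_derive; auto. ring.
  - intros u _. apply (ex_derive_continuous (fun u : R => c * exp (- u) + d)). auto_derive; auto.
Qed.

(** The exponential part of the majorant handles low frequencies and [infprod]; the constant [d]
    will be the high-frequency bound. *)
Lemma Rabs_RInt_le_exp (f : R -> R) (c d a b : R) : a <= b -> ex_RInt f a b ->
  (forall u, a <= u <= b -> Rabs (f u) <= c * exp (- u) + d) ->
  Rabs (RInt f a b) <= c * (exp (- a) - exp (- b)) + d * (b - a).
Proof.
  intros Hab Hex Hf.
  apply (norm_RInt_le f (fun u => c * exp (- u) + d) a b).
  - exact Hab.
  - exact Hf.
  - apply (RInt_correct (V := R_CompleteNormedModule)), Hex.
  - apply is_RInt_exp_majorant.
Qed.

Lemma RInt_split (f : R -> R) (a b c : R) : ex_RInt f a b -> ex_RInt f b c ->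
  RInt f a c = RInt f a b + RInt f b c.
Proof. intros H1 H2. symmetry. exact (RInt_Chasles f a b c H1 H2). Qed.

Lemma RInt_g_tail (x T T' : R) : 0 <= T <= T' ->
  Rabs (RInt (fun u => cos (2 * PI * u * x) * infprod u) 0 T'
        - RInt (fun u => cos (2 * PI * u * x) * infprod u) 0 T) <= 2 * exp (- T).
Proof.
  intros HT.
  rewrite (RInt_split _ 0 T T') by apply ex_RInt_g_integrand.
  unfold Rminus. rewrite Rplus_comm, <- Rplus_assoc, Rplus_opp_l, Rplus_0_l.
  eapply Rle_trans; [apply (Rabs_RInt_le_exp _ 2 0); [lra|apply ex_RInt_g_integrand|]|].
  - intros u Hu. rewrite Rabs_mult, Rplus_0_r.
    pose proof (infprod_le_exp u ltac:(lra)).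
    assert (Rabs (cos (2 * PI * u * x)) <= 1) by apply Rabs_le, COS_bound.
    pose proof (Rabs_pos (infprod u)). nra.
  - pose proof (exp_pos (- T')). lra.
Qed.

Lemma exp_neg_eventually (c eps : R) : 0 < eps ->
  exists T, 0 <= T /\ forall t, T <= t -> c * exp (- t) < eps.
Proof.
  intros He. exists (Rmax 0 (c / eps)). split; [apply Rmax_l|]. intros t Ht.
  pose proof (Rmax_l 0 (c / eps)). pose proof (Rmax_r 0 (c / eps)).
  apply Rmult_lt_reg_r with (exp t); [apply exp_pos|].
  rewrite Rmult_assoc, <- exp_plus, Rplus_opp_l, exp_0, Rmult_1_r.
  pose proof (exp_ineq1_le t).
  assert (Hc : c <= eps * t).
  { replace c with (eps * (c / eps)) by (field; lra). apply Rmult_le_compat_l; lra. }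
  nra.
Qed.

(** The tail bound [RInt_g_tail] is the Cauchy criterion at infinity, so the improper integral
    behind [g] converges. *)
Lemma is_lim_g (x : R) :
  is_lim (fun T => RInt (fun u => cos (2 * PI * u * x) * infprod u) 0 T) p_infty (g x / 2).
Proof.
  set (G := fun T => RInt (fun u => cos (2 * PI * u * x) * infprod u) 0 T).
  assert (Hex : ex_finite_lim G p_infty).
  { destruct (proj1 (@filterlim_locally_cauchy R R_CompleteSpace (Rbar_locally' p_infty) _ G))
      as [l Hl].
    - intros eps. assert (Heps : 0 < eps / 2) by (pose proof (cond_pos eps); lra).
      destruct (exp_neg_eventually 2 (eps / 2) Heps) as [T [HT0 HT]].
      exists (fun t => T < t). split; [exists T; auto|].
      intros s t Hs Ht. change (Rabs (G t - G s) < eps).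
      pose proof (RInt_g_tail x T s ltac:(lra)) as A1.
      pose proof (RInt_g_tail x T t ltac:(lra)) as A2.
      fold (G s) (G T) in A1. fold (G t) (G T) in A2.
      specialize (HT T (Rle_refl _)).
      replace (G t - G s) with ((G t - G T) - (G s - G T)) by ring.
      eapply Rle_lt_trans; [apply Rabs_triang|]. rewrite Rabs_Ropp. lra.
    - exists l. exact Hl. }
  replace (g x / 2) with (real (Lim G p_infty)) by (unfold g; fold G; field).
  apply Lim_correct', Hex.
Qed.

Lemma is_lim_Rabs_minus_le (G : R -> R) (l c B : R) : is_lim G p_infty l ->
  (exists T, forall t, T < t -> Rabs (G t - c) <= B) -> Rabs (l - c) <= B.
Proof.
  intros HG [T HT]. apply Rabs_le. split.
  - assert (H : Rbar_le (c - B) l).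
    { apply (is_lim_le_loc (fun _ => c - B) G p_infty); [|apply is_lim_const|exact HG].
      exists T. intros t Ht. pose proof (proj1 (Rabs_le_between _ _) (HT t Ht)). lra. }
    simpl in H. lra.
  - assert (H : Rbar_le l (c + B)).
    { apply (is_lim_le_loc G (fun _ => c + B) p_infty); [|exact HG|apply is_lim_const].
      exists T. intros t Ht. pose proof (proj1 (Rabs_le_between _ _) (HT t Ht)). lra. }
    simpl in H. lra.
Qed.

Lemma g_approx (x T : R) : 0 <= T ->
  Rabs (g x - 2 * RInt (fun u => cos (2 * PI * u * x) * infprod u) 0 T) <= 4 * exp (- T).
Proof.
  intros HT.
  assert (H : Rabs (g x / 2 - RInt (fun u => cos (2 * PI * u * x) * infprod u) 0 T)
              <= 2 * exp (- T)).
  { apply (is_lim_Rabs_minus_le _ _ _ _ (is_lim_g x)).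
    exists T. intros t Ht. apply RInt_g_tail; lra. }
  apply Rabs_le_between in H. apply Rabs_le. lra.
Qed.

Lemma g_bound (x : R) : Rabs (g x) <= 4.
Proof.
  pose proof (g_approx x 0 (Rle_refl _)) as H.
  rewrite RInt_point in H. unfold zero in H; simpl in H.
  rewrite Ropp_0, exp_0 in H. replace (g x - 2 * 0) with (g x) in H by ring. lra.
Qed.

(** The integrands differ by at most [8 u |x - y| * 2 e^{-u}], and [u e^{-u}] has integral [1]. This
    provides the continuity, hence the integrability, of [g]. *)
Lemma g_lipschitz (x y : R) : Rabs (g x - g y) <= 32 * Rabs (x - y).
Proof.
  set (G := fun z T => RInt (fun u => cos (2 * PI * u * z) * infprod u) 0 T).
  assert (H : Rabs ((g x / 2 - g y / 2) - 0) <= 16 * Rabs (x - y)).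
  { apply (is_lim_Rabs_minus_le (fun T => G x T - G y T)).
    - apply is_lim_minus'; apply is_lim_g.
    - exists 0. intros T HT. rewrite Rminus_0_r. unfold G.
      set (K := 16 * Rabs (x - y)).
      (* The exact integral of [K u e^{-u}] over [[0, T]]. *)
      apply Rle_trans with (K * (1 - (T + 1) * exp (- T))).
      + apply (norm_RInt_le
          (fun u => minus (cos (2 * PI * u * x) * infprod u) (cos (2 * PI * u * y) * infprod u))
          (fun u => K * (u * exp (- u))) 0 T); [lra| | |].
        * intros u Hu. unfold minus, plus, opp, norm; simpl. unfold abs; simpl.
          replace (cos (2 * PI * u * x) * infprod u + - (cos (2 * PI * u * y) * infprod u))
            with ((cos (2 * PI * u * x) - cos (2 * PI * u * y)) * infprod u) by ring.
          rewrite Rabs_mult.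
          apply Rle_trans with (8 * u * Rabs (x - y) * (2 * exp (- u))).
          -- apply Rmult_le_compat; try apply Rabs_pos; [|apply infprod_le_exp; lra].
             eapply Rle_trans; [apply Rabs_cos_minus_le|].
             replace (2 * PI * u * x - 2 * PI * u * y) with (2 * PI * u * (x - y)) by ring.
             rewrite Rabs_mult. apply Rmult_le_compat_r; [apply Rabs_pos|].
             pose proof PI_4. pose proof PI_RGT_0. rewrite Rabs_pos_eq; nra.
          -- right. unfold K. ring.
        * apply (is_RInt_minus (fun u => cos (2 * PI * u * x) * infprod u));
            apply (RInt_correct (V := R_CompleteNormedModule)), ex_RInt_g_integrand.
        * replace (K * (1 - (T + 1) * exp (- T)))
            with (minus (- K * ((T + 1) * exp (- T))) (- K * ((0 + 1) * exp (- 0))))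
            by (unfold minus, plus, opp; simpl; rewrite Ropp_0, exp_0; ring).
          apply (is_RInt_derive (fun u => - K * ((u + 1) * exp (- u)))).
          -- intros u _. auto_derive; auto. ring.
          -- intros u _. apply (ex_derive_continuous (fun u : R => K * (u * exp (- u)))).
             auto_derive; auto.
      + assert (0 <= K) by (unfold K; pose proof (Rabs_pos (x - y)); lra).
        pose proof (exp_pos (- T)).
        assert (0 <= K * ((T + 1) * exp (- T))) by (apply Rmult_le_pos; nra). lra. }
  rewrite Rminus_0_r in H.
  replace (g x - g y) with (2 * (g x / 2 - g y / 2)) by field.
  rewrite Rabs_mult, (Rabs_pos_eq 2); lra.
Qed.

Lemma ex_RInt_g (a b : R) : ex_RInt g a b.
Proof.
  apply (@ex_RInt_continuous R_CompleteNormedModule). intros z _.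
  apply filterlim_locally. intros eps. pose proof (cond_pos eps) as He.
  exists (mkposreal (eps / 33) ltac:(lra)). intros y Hy.
  change (Rabs (y - z) < eps / 33) in Hy. change (Rabs (g y - g z) < eps).
  eapply Rle_lt_trans; [apply g_lipschitz|]. lra.
Qed.

(** * Averages over sign vectors *)

Definition lsum {A : Type} (F : A -> R) (l : list A) : R :=
  fold_right (fun s acc => F s + acc) 0 l.

Definition mean (N : nat) (F : R -> R) : R :=
  lsum (fun s => F (XN s)) (all_signs N) / 2 ^ N.

Lemma lsum_app {A : Type} (F : A -> R) (l l' : list A) : lsum F (l ++ l') = lsum F l + lsum F l'.
Proof. induction l as [|a l IH]; simpl; [ring|]. unfold lsum in *. rewrite IH. ring. Qed.

Lemma lsum_map {A B : Type} (F : B -> R) (f : A -> B) (l : list A) :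
  lsum F (map f l) = lsum (fun a => F (f a)) l.
Proof. induction l as [|a l IH]; simpl; [reflexivity|]. unfold lsum in *. rewrite IH. ring. Qed.

Lemma lsum_ext {A : Type} (F G : A -> R) (l : list A) :
  (forall a, F a = G a) -> lsum F l = lsum G l.
Proof.
  intros H. induction l as [|a l IH]; simpl; [reflexivity|].
  unfold lsum in *. rewrite IH, H. reflexivity.
Qed.

Lemma lsum_lin {A : Type} (F G : A -> R) (c d : R) (l : list A) :
  lsum (fun a => c * F a + d * G a) l = c * lsum F l + d * lsum G l.
Proof. induction l as [|a l IH]; simpl; [ring|]. unfold lsum in *. rewrite IH. ring. Qed.

Lemma lsum_le {A : Type} (F G : A -> R) (l : list A) :
  (forall a, F a <= G a) -> lsum F l <= lsum G l.
Proof.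
  intros H. induction l as [|a l IH]; simpl; [lra|].
  unfold lsum in *. pose proof (H a). lra.
Qed.

Lemma lsum_const {A : Type} (c : R) (l : list A) : lsum (fun _ => c) l = INR (length l) * c.
Proof.
  induction l as [|a l IH]; [simpl; ring|].
  cbn [length]. rewrite S_INR. unfold lsum in *. cbn [fold_right]. rewrite IH. ring.
Qed.

Lemma lsum_indicator {A : Type} (p : A -> bool) (l : list A) :
  lsum (fun a => if p a then 1 else 0) l = INR (length (filter p l)).
Proof.
  induction l as [|a l IH]; [reflexivity|].
  unfold lsum in *. cbn [fold_right filter]. rewrite IH. destruct (p a); cbn [length].
  - rewrite S_INR. ring.
  - ring.
Qed.

Lemma is_RInt_lsum {A : Type} (F : A -> R -> R) (I : A -> R) (a b : R) (l : list A) :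
  (forall s, is_RInt (F s) a b (I s)) ->
  is_RInt (fun x => lsum (fun s => F s x) l) a b (lsum I l).
Proof.
  intros H. induction l as [|s l IH]; simpl.
  - pose proof (is_RInt_const (V := R_NormedModule) a b 0) as H0.
    change (scal (b - a) 0) with ((b - a) * 0) in H0. rewrite Rmult_0_r in H0. exact H0.
  - apply (is_RInt_plus (F s)); [apply H|exact IH].
Qed.

Lemma length_all_signs (N : nat) : INR (length (all_signs N)) = 2 ^ N.
Proof.
  induction N as [|N IH]; [reflexivity|].
  cbn [all_signs pow]. rewrite length_app, !length_map, plus_INR, IH. ring.
Qed.

Lemma mean_le (N : nat) (F G : R -> R) : (forall X, F X <= G X) -> mean N F <= mean N G.
Proof.
  intros H. unfold mean, Rdiv. apply Rmult_le_compat_r.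
  - left. apply Rinv_0_lt_compat, pow_lt; lra.
  - apply lsum_le. auto.
Qed.

Lemma mean_lin (N : nat) (F G : R -> R) (c d : R) :
  mean N (fun X => c * F X + d * G X) = c * mean N F + d * mean N G.
Proof.
  unfold mean. rewrite lsum_lin. field. apply pow_nonzero; lra.
Qed.

Lemma mean_scal (N : nat) (F : R -> R) (c : R) : mean N (fun X => c * F X) = c * mean N F.
Proof.
  replace (c * mean N F) with (c * mean N F + 0 * mean N F) by ring.
  rewrite <- mean_lin. unfold mean. f_equal. apply lsum_ext. intro s. ring.
Qed.

Lemma mean_const (N : nat) (c : R) : mean N (fun _ => c) = c.
Proof.
  unfold mean. rewrite lsum_const, length_all_signs. field. apply pow_nonzero; lra.
Qed.

Lemma mean_dist (N : nat) (F G : R -> R) (B : R) :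
  (forall X, Rabs (F X - G X) <= B) -> Rabs (mean N F - mean N G) <= B.
Proof.
  intros H.
  assert (H' : forall X, - B <= F X - G X <= B) by (intro X; apply Rabs_le_between, H).
  assert (E : forall c, mean N (fun X => 1 * G X + c * 1) = mean N G + c).
  { intros c. rewrite (mean_lin N G (fun _ => 1)), mean_const. ring. }
  apply Rabs_le. split.
  - pose proof (mean_le N (fun X => 1 * G X + - B * 1) F) as H1. rewrite E in H1.
    enough (mean N G + - B <= mean N F) by lra. apply H1. intro X. specialize (H' X). lra.
  - pose proof (mean_le N F (fun X => 1 * G X + B * 1)) as H1. rewrite E in H1.
    enough (mean N F <= mean N G + B) by lra. apply H1. intro X. specialize (H' X). lra.
Qed.

Lemma is_RInt_mean (N : nat) (F : R -> R -> R) (I : R -> R) (a b : R) :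
  (forall X, is_RInt (F X) a b (I X)) ->
  is_RInt (fun x => mean N (fun X => F X x)) a b (mean N I).
Proof.
  intros H. unfold mean.
  apply (is_RInt_ext (fun x => scal (/ 2 ^ N) (lsum (fun s => F (XN s) x) (all_signs N)))).
  - intros x _. unfold scal; simpl. unfold mult; simpl. unfold Rdiv. ring.
  - unfold Rdiv. rewrite Rmult_comm.
    apply (is_RInt_scal (fun x => lsum (fun s => F (XN s) x) (all_signs N))).
    apply (is_RInt_lsum (fun s => F (XN s))). auto.
Qed.

Lemma probXN_mean (N : nat) (lc rc : bool) (a b : R) :
  probXN N lc rc a b = mean N (fun X => if in_itv lc rc a b X then 1 else 0).
Proof.
  unfold probXN, mean. rewrite <- lsum_indicator. reflexivity.
Qed.

(** * The characteristic function of [X_N] *)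

(** Factors are peeled off at the front, as [XN_aux] consumes signs, whereas [prod_cos] peels them
    off at the end. *)
Fixpoint cos_prod_from (t : R) (k M : nat) : R :=
  match M with
  | O => 1
  | S M' => cos (t / INR (S k)) * cos_prod_from t (S k) M'
  end.

Lemma cos_prod_from_S (t : R) (k M : nat) :
  cos_prod_from t k (S M) = cos_prod_from t k M * cos (t / INR (S (k + M))).
Proof.
  revert k. induction M as [|M IH]; intros k.
  - cbn [cos_prod_from]. rewrite Nat.add_0_r. ring.
  - change (cos_prod_from t k (S (S M)))
      with (cos (t / INR (S k)) * cos_prod_from t (S k) (S M)).
    rewrite IH. cbn [cos_prod_from].
    replace (S k + M)%nat with (k + S M)%nat by lia. ring.
Qed.

Lemma prod_cos_eq (u : R) (N : nat) : prod_cos u N = cos_prod_from (2 * PI * u) 0 N.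
Proof.
  induction N as [|N IH]; [reflexivity|].
  rewrite cos_prod_from_S, <- IH. reflexivity.
Qed.

(** The phase [theta] is free because the first sign shifts it by [d = t / (k+1)] up or down; then
    [cos (theta + d) + cos (theta - d) = 2 cos theta cos d]. *)
Lemma lsum_cos (t theta : R) (k M : nat) :
  lsum (fun s => cos (theta + t * XN_aux k s)) (all_signs M)
  = 2 ^ M * (cos theta * cos_prod_from t k M).
Proof.
  revert theta k. induction M as [|M IH]; intros theta k.
  - simpl. rewrite Rmult_0_r, !Rplus_0_r. ring.
  - cbn [all_signs]. rewrite lsum_app, !lsum_map.
    rewrite (lsum_ext _ (fun s => cos ((theta + t / INR (S k)) + t * XN_aux (S k) s)))
      by (intro s; cbn [XN_aux sgn]; f_equal; field; apply not_0_INR; lia).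
    rewrite (lsum_ext (fun a => cos (theta + t * XN_aux k (false :: a)))
              (fun s => cos ((theta - t / INR (S k)) + t * XN_aux (S k) s)))
      by (intro s; cbn [XN_aux sgn]; f_equal; field; apply not_0_INR; lia).
    rewrite !IH, cos_plus, cos_minus. cbn [cos_prod_from pow]. ring.
Qed.

Lemma mean_cos (N : nat) (u x : R) :
  mean N (fun X => cos (2 * PI * u * (x - X))) = cos (2 * PI * u * x) * prod_cos u N.
Proof.
  unfold mean.
  rewrite (lsum_ext _ (fun s => cos (- (2 * PI * u * x) + 2 * PI * u * XN_aux 0 s))).
  - rewrite lsum_cos, cos_neg, <- prod_cos_eq. field. apply pow_nonzero; lra.
  - intros s. rewrite <- cos_neg. f_equal. unfold XN. ring.
Qed.

(** * The Poisson kernel and truncated Fourier inversion *)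

Definition poisson (h y : R) : R := h / (PI * (h ^ 2 + y ^ 2)).

Lemma sum_sq_pos (h y : R) : 0 < h -> 0 < h ^ 2 + y ^ 2.
Proof. intros Hh. pose proof (pow_lt h 2 Hh). pose proof (pow2_ge_0 y). lra. Qed.

Lemma is_RInt_damped_cos (h y U : R) : 0 < h ->
  is_RInt (fun u => exp (- (2 * PI * h * u)) * cos (2 * PI * u * y)) 0 U
    (exp (- (2 * PI * h * U)) * (y * sin (2 * PI * U * y) - h * cos (2 * PI * U * y))
      / (2 * PI * (h ^ 2 + y ^ 2)) + poisson h y / 2).
Proof.
  intros Hh. pose proof (sum_sq_pos h y Hh) as Hs. pose proof PI_RGT_0 as HPI.
  set (F := fun u => exp (- (2 * PI * h * u)) * (y * sin (2 * PI * u * y) - h * cos (2 * PI * u * y))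
      / (2 * PI * (h ^ 2 + y ^ 2))).
  match goal with |- is_RInt _ _ _ ?v => replace v with (minus (F U) (F 0)) end.
  - apply (is_RInt_derive F).
    + intros u _. unfold F. auto_derive; [auto|]. field. split; lra.
    + intros u _.
      apply (ex_derive_continuous (fun u : R => exp (- (2 * PI * h * u)) * cos (2 * PI * u * y))).
      auto_derive; auto.
  - unfold F, poisson, minus, plus, opp; simpl.
    replace (2 * PI * h * 0) with 0 by ring. replace (2 * PI * 0 * y) with 0 by ring.
    rewrite Ropp_0, exp_0, sin_0, cos_0. field. split; simpl in Hs; lra.
Qed.

(** The error is the boundary term at [U], controlled by [h (|y| + h) <= 2 (h^2 + y^2)] and
    [PI >= 2]. It is uniform in [y], so it survives averaging over [X_N]. *)
Lemma poisson_fourier (h y U : R) : 0 < h ->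
  Rabs (2 * RInt (fun u => exp (- (2 * PI * h * u)) * cos (2 * PI * u * y)) 0 U - poisson h y)
  <= exp (- (2 * PI * h * U)) / h.
Proof.
  intros Hh. pose proof (sum_sq_pos h y Hh) as Hs. pose proof PI2_1 as HPI.
  rewrite (is_RInt_unique _ _ _ _ (is_RInt_damped_cos h y U Hh)).
  set (E := exp (- (2 * PI * h * U))). set (s := sin (2 * PI * U * y)).
  set (c := cos (2 * PI * U * y)). set (q := h ^ 2 + y ^ 2) in *.
  replace (2 * (E * (y * s - h * c) / (2 * PI * q) + poisson h y / 2) - poisson h y)
    with (E * ((y * s - h * c) / (PI * q))) by (field; lra).
  assert (HE : 0 < E) by apply exp_pos.
  rewrite Rabs_mult, (Rabs_pos_eq E) by lra. unfold Rdiv at 2.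
  apply Rmult_le_compat_l; [lra|].
  unfold Rdiv. rewrite Rabs_mult, (Rabs_pos_eq (/ (PI * q)))
    by (left; apply Rinv_0_lt_compat, Rmult_lt_0_compat; lra).
  apply Rmult_le_reg_r with (PI * q * h); [apply Rmult_lt_0_compat; [apply Rmult_lt_0_compat|]; lra|].
  replace (Rabs (y * s - h * c) * / (PI * q) * (PI * q * h)) with (h * Rabs (y * s - h * c))
    by (field; lra).
  replace (/ h * (PI * q * h)) with (PI * q) by (field; lra).
  assert (Hb : Rabs (y * s - h * c) <= Rabs y + h).
  { eapply Rle_trans; [apply Rabs_triang|]. rewrite Rabs_Ropp, !Rabs_mult, (Rabs_pos_eq h) by lra.
    assert (Rabs s <= 1) by apply Rabs_le, SIN_bound.
    assert (Rabs c <= 1) by apply Rabs_le, COS_bound.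
    pose proof (Rabs_pos y). nra. }
  assert (Hq : h * (Rabs y + h) <= 2 * q).
  { unfold q. rewrite <- (pow2_abs y). pose proof (Rabs_pos y). simpl. nra. }
  nra.
Qed.

Lemma is_RInt_poisson (h X a b : R) : 0 < h ->
  is_RInt (fun x => poisson h (x - X)) a b ((atan ((b - X) / h) - atan ((a - X) / h)) / PI).
Proof.
  intros Hh. pose proof PI_RGT_0 as HPI.
  replace ((atan ((b - X) / h) - atan ((a - X) / h)) / PI)
    with (minus (atan ((b - X) / h) / PI) (atan ((a - X) / h) / PI))
    by (unfold minus, plus, opp; simpl; field; lra).
  apply (is_RInt_derive (fun x => atan ((x - X) / h) / PI)).
  - intros x _. unfold poisson. pose proof (sum_sq_pos h (x - X) Hh) as Hs.
    auto_derive; [auto|]. field. repeat split; try lra; simpl in *; nra.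
  - intros x _. pose proof (sum_sq_pos h (x - X) Hh) as Hs.
    apply (ex_derive_continuous (fun x : R => poisson h (x - X))).
    unfold poisson. auto_derive. simpl in Hs. nra.
Qed.

(** * The smoothed law of [X_N] compared with [g] *)

Lemma ex_RInt_damped_prod_cos (h x a b : R) (N : nat) :
  ex_RInt (fun u => exp (- (2 * PI * h * u)) * (cos (2 * PI * u * x) * prod_cos u N)) a b.
Proof.
  apply (@ex_RInt_continuous R_CompleteNormedModule). intros z _.
  apply (continuous_mult (fun u : R => exp (- (2 * PI * h * u)))
    (fun u => cos (2 * PI * u * x) * prod_cos u N)).
  - apply (ex_derive_continuous (fun u : R => exp (- (2 * PI * h * u)))). auto_derive; auto.
  - apply (continuous_mult (fun u => cos (2 * PI * u * x)) (fun u => prod_cos u N));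
      [apply continuous_cos_freq|apply continuous_prod_cos].
Qed.

Lemma mean_poisson_fourier (N : nat) (h x U : R) : 0 < h ->
  Rabs (2 * RInt (fun u => exp (- (2 * PI * h * u)) * (cos (2 * PI * u * x) * prod_cos u N)) 0 U
        - mean N (fun X => poisson h (x - X)))
  <= exp (- (2 * PI * h * U)) / h.
Proof.
  intros Hh.
  set (J := fun X => RInt (fun u => exp (- (2 * PI * h * u)) * cos (2 * PI * u * (x - X))) 0 U).
  assert (E : RInt (fun u => exp (- (2 * PI * h * u)) * (cos (2 * PI * u * x) * prod_cos u N)) 0 U
              = mean N J).
  { apply is_RInt_unique.
    apply (is_RInt_ext (fun u => mean N (fun X => exp (- (2 * PI * h * u)) * cos (2 * PI * u * (x - X))))).
    - intros u _.
      rewrite mean_scal, mean_cos. reflexivity.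
    - apply (is_RInt_mean N (fun X u => exp (- (2 * PI * h * u)) * cos (2 * PI * u * (x - X)))).
      intros X. apply (RInt_correct (V := R_CompleteNormedModule)).
      eexists. apply is_RInt_damped_cos, Hh. }
  rewrite E, <- mean_scal. apply mean_dist. intros X. apply poisson_fourier, Hh.
Qed.

(** A wider kernel only increases the damping, so every [r >= h] obeys the bound available at
    [h]. *)
Lemma mean_poisson_bound (N : nat) (h r x U eta : R) : 0 < h <= r -> 0 <= U ->
  (forall u, 0 <= u <= U -> Rabs (prod_cos u N) <= 2 * exp (- u) + eta) ->
  mean N (fun X => poisson r (x - X)) <= exp (- (2 * PI * h * U)) / h + 2 * (2 + eta * U).
Proof.
  intros [Hh Hr] HU Hrho. pose proof PI_RGT_0 as HPI.
  pose proof (mean_poisson_fourier N r x U ltac:(lra)) as H1.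
  set (J := RInt (fun u => exp (- (2 * PI * r * u)) * (cos (2 * PI * u * x) * prod_cos u N)) 0 U) in *.
  assert (HJ : Rabs J <= 2 * (exp (- 0) - exp (- U)) + eta * (U - 0)).
  { apply Rabs_RInt_le_exp; [exact HU|apply ex_RInt_damped_prod_cos|].
    intros u Hu. specialize (Hrho u Hu). rewrite !Rabs_mult.
    assert (Rabs (cos (2 * PI * u * x)) <= 1) by apply Rabs_le, COS_bound.
    assert (H2 : exp (- (2 * PI * r * u)) <= 1).
    { rewrite <- exp_0. apply exp_mono. assert (0 <= 2 * PI * r * u) by (apply Rmult_le_pos; nra). lra. }
    rewrite (Rabs_pos_eq (exp _)) by (left; apply exp_pos).
    pose proof (exp_pos (- (2 * PI * r * u))).
    pose proof (Rabs_pos (prod_cos u N)). pose proof (Rabs_pos (cos (2 * PI * u * x))).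
    apply Rle_trans with (1 * (1 * Rabs (prod_cos u N))); [|lra].
    apply Rmult_le_compat; try nra. }
  rewrite Ropp_0, exp_0 in HJ. pose proof (exp_pos (- U)).
  assert (HE : exp (- (2 * PI * r * U)) / r <= exp (- (2 * PI * h * U)) / h).
  { apply Rmult_le_compat.
    - left; apply exp_pos.
    - left; apply Rinv_0_lt_compat; lra.
    - apply exp_mono, Ropp_le_contravar. apply Rmult_le_compat_r; [exact HU|].
      apply Rmult_le_compat_l; lra.
    - apply Rinv_le_contravar; lra. }
  apply Rabs_le_between in H1. apply Rabs_le_between in HJ. lra.
Qed.

(** On [[0, T]] the finite product is near the infinite one and the damping near [1]; on [[T, U]]
    both integrands are small; beyond [U] remain the inversion error and the tail of [g]. The [12]
    is twice the [4] of the middle range plus the [4] of that tail. *)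
Lemma mean_poisson_approx (N : nat) (h x T U eta : R) : (1 <= N)%nat -> 0 < h -> 0 <= T <= U ->
  0 <= eta ->
  (forall u, 0 <= u <= U -> Rabs (prod_cos u N) <= 2 * exp (- u) + eta) ->
  Rabs (mean N (fun X => poisson h (x - X)) - g x)
  <= exp (- (2 * PI * h * U)) / h + 12 * exp (- T)
     + 2 * (T * (32 * T ^ 2 / INR N + 8 * h * T)) + 2 * (eta * U).
Proof.
  intros HN Hh HT Heta Hrho. pose proof PI_RGT_0 as HPI. pose proof PI_4 as HPI4.
  pose proof (mean_poisson_fourier N h x U Hh) as H1.
  pose proof (g_approx x U ltac:(lra)) as H2.
  set (f1 := fun u => exp (- (2 * PI * h * u)) * (cos (2 * PI * u * x) * prod_cos u N)) in *.
  set (f2 := fun u => cos (2 * PI * u * x) * infprod u) in *.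
  set (f := fun u => minus (f1 u) (f2 u)).
  assert (Hex : forall a b, ex_RInt f a b).
  { intros a b. apply (ex_RInt_minus f1 f2); [apply ex_RInt_damped_prod_cos|apply ex_RInt_g_integrand]. }
  assert (E : RInt f1 0 U - RInt f2 0 U = RInt f 0 T + RInt f T U).
  { rewrite <- RInt_split by apply Hex. symmetry.
    apply (RInt_minus (V := R_CompleteNormedModule) f1 f2);
      [apply ex_RInt_damped_prod_cos|apply ex_RInt_g_integrand]. }
  assert (Hcos : forall u, Rabs (cos (2 * PI * u * x)) <= 1)
    by (intro u; apply Rabs_le, COS_bound).
  assert (Hexp : forall u, 0 <= u -> 0 < exp (- (2 * PI * h * u)) <= 1).
  { intros u Hu. split; [apply exp_pos|]. rewrite <- exp_0. apply exp_mono.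
    assert (0 <= 2 * PI * h * u) by (apply Rmult_le_pos; nra). lra. }
  assert (HN0 : 0 < INR N) by (apply lt_0_INR; lia).
  assert (A1 : Rabs (RInt f 0 T) <= (T - 0) * (32 * T ^ 2 / INR N + 8 * h * T)).
  { apply abs_RInt_le_const; [lra|apply Hex|]. intros u Hu.
    (* Separates the damping error from the truncation error of the product. *)
    replace (f u) with (cos (2 * PI * u * x) *
      (- ((1 - exp (- (2 * PI * h * u))) * prod_cos u N) - (infprod u - prod_cos u N)))
      by (unfold f, f1, f2, minus, plus, opp; simpl; ring).
    rewrite Rabs_mult.
    apply Rle_trans with (1 * (32 * T ^ 2 / INR N + 8 * h * T)); [|lra].
    apply Rmult_le_compat; auto using Rabs_pos.
    eapply Rle_trans; [apply Rabs_triang|]. rewrite !Rabs_Ropp, Rabs_mult.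
    assert (B1 : Rabs (infprod u - prod_cos u N) <= 32 * T ^ 2 / INR N).
    { eapply Rle_trans; [apply infprod_approx, HN|]. unfold Rdiv.
      apply Rmult_le_compat_r; [left; apply Rinv_0_lt_compat, HN0|].
      apply Rmult_le_compat_l; [lra|]. apply pow_incr; lra. }
    assert (B2 : Rabs (1 - exp (- (2 * PI * h * u))) <= 8 * h * T).
    { specialize (Hexp u ltac:(lra)). rewrite Rabs_pos_eq by lra.
      pose proof (exp_ineq1_le (- (2 * PI * h * u))).
      assert (2 * PI * h * u <= 8 * h * T); [|lra].
      apply Rmult_le_compat; nra. }
    pose proof (Rabs_prod_cos_le_1 u N). pose proof (Rabs_pos (prod_cos u N)).
    pose proof (Rabs_pos (1 - exp (- (2 * PI * h * u)))). nra. }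
  assert (A2 : Rabs (RInt f T U) <= 4 * (exp (- T) - exp (- U)) + eta * (U - T)).
  { apply Rabs_RInt_le_exp; [lra|apply Hex|]. intros u Hu.
    unfold f, f1, f2, minus, plus, opp; simpl.
    eapply Rle_trans; [apply Rabs_triang|]. rewrite Rabs_Ropp, !Rabs_mult.
    specialize (Hrho u ltac:(lra)). specialize (Hcos u). specialize (Hexp u ltac:(lra)).
    pose proof (infprod_le_exp u ltac:(lra)).
    rewrite (Rabs_pos_eq (exp _)) by lra.
    pose proof (Rabs_pos (prod_cos u N)). pose proof (Rabs_pos (cos (2 * PI * u * x))).
    pose proof (Rabs_pos (infprod u)).
    assert (exp (- (2 * PI * h * u)) * (Rabs (cos (2 * PI * u * x)) * Rabs (prod_cos u N))
      <= 1 * (1 * Rabs (prod_cos u N))) by (apply Rmult_le_compat; nra).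
    assert (Rabs (cos (2 * PI * u * x)) * Rabs (infprod u) <= 1 * Rabs (infprod u))
      by (apply Rmult_le_compat_r; lra).
    lra. }
  assert (HTU : exp (- U) <= exp (- T)) by (apply exp_mono; lra).
  assert (eta * (U - T) <= eta * U) by (apply Rmult_le_compat_l; lra).
  rewrite Rminus_0_r in A1. pose proof (exp_pos (- U)).
  apply Rabs_le_between in A1. apply Rabs_le_between in A2.
  apply Rabs_le_between in H1. apply Rabs_le_between in H2. apply Rabs_le. lra.
Qed.

(** * Indicators of intervals between Poisson masses *)

(** The integral over [[a, b]] of the kernel of width [h] centred at [X], in the closed form of
    [is_RInt_poisson]. *)
Definition poisson_mass (h a b X : R) : R := (atan ((b - X) / h) - atan ((a - X) / h)) / PI.

Lemma atan_le_id (y : R) : 0 <= y -> atan y <= y.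
Proof.
  intros Hy.
  destruct (MVT_gen atan 0 y (fun x => / (1 + Rsqr x))) as [c [_ Hc]].
  - intros x _. apply is_derive_atan.
  - intros x _. apply continuity_pt_filterlim. apply (ex_derive_continuous atan).
    eexists. apply is_derive_atan.
  - rewrite atan_0, !Rminus_0_r in Hc. rewrite Hc.
    pose proof (Rle_0_sqr c).
    assert (/ (1 + Rsqr c) <= 1) by (rewrite <- Rinv_1; apply Rinv_le_contravar; lra).
    nra.
Qed.

Lemma atan_mono (x y : R) : x <= y -> atan x <= atan y.
Proof. intros [H| ->]; [left; apply atan_increasing; auto|lra]. Qed.

Lemma Rdiv_le_compat (x y h : R) : 0 < h -> x <= y -> x / h <= y / h.
Proof. intros Hh H. apply Rmult_le_compat_r; [left; apply Rinv_0_lt_compat|]; auto. Qed.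

Lemma poisson_mass_bounds (h a b X : R) : 0 < h -> a <= b -> 0 <= poisson_mass h a b X <= 1.
Proof.
  intros Hh Hab. pose proof PI_RGT_0 as HPI. unfold poisson_mass. split.
  - apply Rmult_le_pos; [|left; apply Rinv_0_lt_compat; auto].
    assert (atan ((a - X) / h) <= atan ((b - X) / h)).
    { apply atan_mono, Rdiv_le_compat; lra. }
    lra.
  - apply Rmult_le_reg_r with PI; [auto|].
    replace ((atan ((b - X) / h) - atan ((a - X) / h)) / PI * PI)
      with (atan ((b - X) / h) - atan ((a - X) / h)) by (field; lra).
    pose proof (atan_bound ((b - X) / h)). pose proof (atan_bound ((a - X) / h)). lra.
Qed.

Lemma poisson_mass_near (h r a b X : R) : 0 < h -> 0 < r -> a <= X <= b ->
  2 * atan (r / h) / PI <= poisson_mass h (a - r) (b + r) X.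
Proof.
  intros Hh Hr HX. pose proof PI_RGT_0 as HPI. unfold poisson_mass.
  apply Rdiv_le_compat; [auto|].
  assert (H1 : atan (r / h) <= atan ((b + r - X) / h)) by (apply atan_mono, Rdiv_le_compat; lra).
  assert (H2 : atan ((a - r - X) / h) <= atan (- (r / h))).
  { replace (- (r / h)) with (- r / h) by (field; lra). apply atan_mono, Rdiv_le_compat; lra. }
  rewrite atan_opp in H2. lra.
Qed.

(** The width [h] kernel has mass at least [1 - h/r] within distance [r] of its centre, because
    [atan (r/h) = PI/2 - atan (h/r)]. The width [r] kernel has mass at least [1/2] there, so the
    correction supplies the missing [h/r]. *)
Lemma indicator_le_poisson (h r a b X : R) : 0 < h -> 0 < r -> a <= X <= b ->
  1 <= poisson_mass h (a - r) (b + r) X + 2 * (h / r) * poisson_mass r (a - r) (b + r) X.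
Proof.
  intros Hh Hr HX. pose proof PI2_1 as HPI.
  pose proof (poisson_mass_near h r a b X Hh Hr HX) as H1.
  pose proof (poisson_mass_near r r a b X Hr Hr HX) as H2.
  replace (r / r) with 1 in H2 by (field; lra). rewrite atan_1 in H2.
  replace (2 * (PI / 4) / PI) with (1 / 2) in H2 by (field; lra).
  assert (Hq : 0 < h / r) by (apply Rdiv_lt_0_compat; auto).
  assert (H3 : PI / 2 - h / r <= atan (r / h)).
  { replace (r / h) with (/ (h / r)) by (field; lra).
    rewrite atan_inv by auto. pose proof (atan_le_id (h / r)). lra. }
  assert (H4 : 1 - h / r <= 2 * atan (r / h) / PI).
  { apply Rmult_le_reg_r with PI; [lra|].
    replace (2 * atan (r / h) / PI * PI) with (2 * atan (r / h)) by (field; lra). nra. }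
  nra.
Qed.

(** The inequality holds between the kernels themselves: at distance [|y| >= r],
    [h^2 + y^2 >= (r^2 + y^2) / 2]. *)
Lemma poisson_mass_far (h r a b X : R) : 0 < h -> 0 < r -> a + r <= b - r -> X <= a \/ b <= X ->
  poisson_mass h (a + r) (b - r) X <= 2 * (h / r) * poisson_mass r (a + r) (b - r) X.
Proof.
  intros Hh Hr Hab HX. pose proof PI_RGT_0 as HPI.
  apply (is_RInt_le (fun x => poisson h (x - X)) (fun x => scal (2 * (h / r)) (poisson r (x - X)))
    (a + r) (b - r)); [lra|apply is_RInt_poisson, Hh| |].
  - apply (is_RInt_scal (fun x => poisson r (x - X))). apply is_RInt_poisson, Hr.
  - intros x Hx. change (poisson h (x - X) <= 2 * (h / r) * poisson r (x - X)).
    set (y := x - X).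
    assert (Hy : r ^ 2 <= y ^ 2) by (unfold y; destruct HX; simpl; nra).
    pose proof (sum_sq_pos h y Hh) as S1. pose proof (sum_sq_pos r y Hr) as S2.
    unfold poisson.
    replace (2 * (h / r) * (r / (PI * (r ^ 2 + y ^ 2))))
      with (h / (PI * ((r ^ 2 + y ^ 2) / 2))) by (field; lra).
    apply Rmult_le_compat_l; [lra|]. apply Rinv_le_contravar.
    + apply Rmult_lt_0_compat; lra.
    + apply Rmult_le_compat_l; [lra|]. pose proof (pow2_ge_0 h). lra.
Qed.

Lemma is_RInt_mean_poisson (N : nat) (h a b : R) : 0 < h ->
  is_RInt (fun x => mean N (fun X => poisson h (x - X))) a b (mean N (poisson_mass h a b)).
Proof.
  intros Hh. apply (is_RInt_mean N (fun X x => poisson h (x - X))).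
  intros X. apply is_RInt_poisson, Hh.
Qed.

Lemma Rabs_RInt_g_le (a b : R) : a <= b -> Rabs (RInt g a b) <= 4 * (b - a).
Proof.
  intros Hab. rewrite Rmult_comm.
  apply abs_RInt_le_const; auto using ex_RInt_g, g_bound.
Qed.

Lemma in_itv_true (lc rc : bool) (a b x : R) : in_itv lc rc a b x = true -> a <= x <= b.
Proof.
  unfold in_itv. destruct lc, rc; repeat destruct Rle_dec; repeat destruct Rlt_dec;
    simpl; intros H; try discriminate; lra.
Qed.

Lemma in_itv_false (lc rc : bool) (a b x : R) : in_itv lc rc a b x = false -> x <= a \/ b <= x.
Proof.
  unfold in_itv. destruct lc, rc; repeat destruct Rle_dec; repeat destruct Rlt_dec;
    simpl; intros H; try discriminate; lra.
Qed.

(** Shrinking or enlarging the interval changes the integral of [g] over two strips of length [r],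
    which costs [8 r] since [|g| <= 4]. The rest is the approximation error [e] and the correction
    kernel, integrated over at most the enlarged interval. *)
Lemma probXN_sandwich (N : nat) (h r e B : R) (lc rc : bool) (a b : R) :
  0 < h -> 0 < r -> 2 * r <= b - a ->
  (forall x, Rabs (mean N (fun X => poisson h (x - X)) - g x) <= e) ->
  (forall x, mean N (fun X => poisson r (x - X)) <= B) ->
  Rabs (probXN N lc rc a b - RInt g a b) <= 8 * r + (e + 2 * (h / r) * B) * (b - a + 2 * r).
Proof.
  intros Hh Hr Hab He HB. rewrite probXN_mean.
  assert (Hq : 0 < h / r) by (apply Rdiv_lt_0_compat; auto).
  assert (He0 : 0 <= e) by (eapply Rle_trans; [apply Rabs_pos|apply (He 0)]).
  assert (HB0 : 0 <= B).
  { eapply Rle_trans; [|apply (HB 0)]. rewrite <- (mean_const N 0) at 1.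
    apply mean_le. intros X. unfold poisson. apply Rmult_le_pos; [lra|].
    left. apply Rinv_0_lt_compat, Rmult_lt_0_compat; [apply PI_RGT_0|apply sum_sq_pos, Hr]. }
  assert (Hmass : forall c d, c <= d ->
    Rabs (mean N (poisson_mass h c d) - RInt g c d) <= e * (d - c) /\
    mean N (poisson_mass r c d) <= B * (d - c)).
  { intros c d Hcd. split.
    - replace (e * (d - c)) with (scal (d - c) e) by (unfold scal; simpl; unfold mult; simpl; ring).
      apply (norm_RInt_le (fun x => minus (mean N (fun X => poisson h (x - X))) (g x)) (fun _ => e) c d);
        [exact Hcd|intros x _; apply He| |apply (is_RInt_const (V := R_NormedModule))].
      apply (is_RInt_minus (fun x => mean N (fun X => poisson h (x - X)))).
      + apply is_RInt_mean_poisson, Hh.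
      + apply (RInt_correct (V := R_CompleteNormedModule)), ex_RInt_g.
    - replace (B * (d - c)) with (scal (d - c) B) by (unfold scal; simpl; unfold mult; simpl; ring).
      apply (is_RInt_le (fun x => mean N (fun X => poisson r (x - X))) (fun _ => B) c d);
        [exact Hcd|apply is_RInt_mean_poisson, Hr|apply (is_RInt_const (V := R_NormedModule))|].
      intros x _. apply HB. }
  assert (Hlin : forall c d k, mean N (fun X => 1 * poisson_mass h c d X + k * poisson_mass r c d X)
    = mean N (poisson_mass h c d) + k * mean N (poisson_mass r c d)).
  { intros c d k. rewrite (mean_lin N (poisson_mass h c d)). ring. }
  assert (HqB : 0 <= h / r * B) by (apply Rmult_le_pos; lra).
  assert (Hup : mean N (fun X => if in_itv lc rc a b X then 1 else 0)
    <= mean N (poisson_mass h (a - r) (b + r)) + 2 * (h / r) * mean N (poisson_mass r (a - r) (b + r))).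
  { rewrite <- Hlin. apply mean_le. intros X. rewrite Rmult_1_l.
    destruct (in_itv lc rc a b X) eqn:E.
    - apply in_itv_true in E. apply indicator_le_poisson; auto.
    - pose proof (poisson_mass_bounds h (a - r) (b + r) X Hh ltac:(lra)).
      pose proof (poisson_mass_bounds r (a - r) (b + r) X Hr ltac:(lra)). nra. }
  assert (Hlo : mean N (poisson_mass h (a + r) (b - r))
      + - (2 * (h / r)) * mean N (poisson_mass r (a + r) (b - r))
    <= mean N (fun X => if in_itv lc rc a b X then 1 else 0)).
  { rewrite <- Hlin. apply mean_le. intros X. rewrite Rmult_1_l.
    destruct (in_itv lc rc a b X) eqn:E.
    (* Inside the interval the minorant is at most [1] because a Poisson mass is; outside,
       [poisson_mass_far] makes it nonpositive. *)
    - pose proof (poisson_mass_bounds h (a + r) (b - r) X Hh ltac:(lra)).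
      pose proof (poisson_mass_bounds r (a + r) (b - r) X Hr ltac:(lra)). nra.
    - apply in_itv_false in E.
      pose proof (poisson_mass_far h r a b X Hh Hr ltac:(lra) E). lra. }
  destruct (Hmass (a - r) (b + r) ltac:(lra)) as [U1 U2].
  destruct (Hmass (a + r) (b - r) ltac:(lra)) as [L1 L2].
  rewrite (RInt_split g (a - r) a (b + r)), (RInt_split g a b (b + r)) in U1 by apply ex_RInt_g.
  assert (EL : RInt g a b = RInt g a (a + r) + (RInt g (a + r) (b - r) + RInt g (b - r) b)).
  { rewrite (RInt_split g a (a + r) b), (RInt_split g (a + r) (b - r) b) by apply ex_RInt_g. reflexivity. }
  pose proof (Rabs_RInt_g_le (a - r) a ltac:(lra)) as G1.
  pose proof (Rabs_RInt_g_le b (b + r) ltac:(lra)) as G2.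
  pose proof (Rabs_RInt_g_le a (a + r) ltac:(lra)) as G3.
  pose proof (Rabs_RInt_g_le (b - r) b ltac:(lra)) as G4.
  apply Rabs_le_between in U1, L1, G1, G2, G3, G4.
  assert (U3 : 2 * (h / r) * mean N (poisson_mass r (a - r) (b + r))
    <= 2 * (h / r) * (B * (b - a + 2 * r))) by (apply Rmult_le_compat_l; lra).
  assert (L3 : 2 * (h / r) * mean N (poisson_mass r (a + r) (b - r))
    <= 2 * (h / r) * (B * (b - a + 2 * r))).
  { apply Rmult_le_compat_l; [lra|]. eapply Rle_trans; [exact L2|].
    apply Rmult_le_compat_l; lra. }
  assert (L4 : e * (b - r - (a + r)) <= e * (b - a + 2 * r)) by (apply Rmult_le_compat_l; lra).
  apply Rabs_le. split; lra.
Qed.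

(** * Choice of scales and conclusion *)

Lemma sq_ln_eventually (W : R) :
  exists N0 : nat, forall N, (N0 <= N)%nat -> (3 <= N)%nat /\ W <= ln (INR N) ^ 2.
Proof.
  destruct (ln_eventually (Rmax 1 W)) as [N0 H]. exists N0. intros N HN.
  destruct (H N HN) as [H3 HL]. split; [exact H3|].
  pose proof (Rmax_l 1 W). pose proof (Rmax_r 1 W). simpl. nra.
Qed.

(** With [w = ln^2 N], the exponent [C + 1] is chosen so that the constant term, integrated up to
    [exp (C w)], contributes at most [exp (- w)]. *)
Lemma prod_cos_majorant (C : R) : 0 < C < 1 / ln 4 ->
  exists N0 : nat, forall N, (N0 <= N)%nat -> forall u,
    0 <= u <= exp (C * ln (INR N) ^ 2) ->
    Rabs (prod_cos u N) <= 2 * exp (- u) + exp (- ((C + 1) * ln (INR N) ^ 2)).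
Proof.
  intros HC. destruct (prod_cos_le_high C (C + 1) HC ltac:(lra)) as [N0 H].
  exists N0. intros N HN u Hu.
  pose proof (exp_pos (- u)). pose proof (exp_pos (- ((C + 1) * ln (INR N) ^ 2))).
  destruct (Rle_lt_dec u (INR N / 8)) as [Hl|Hl].
  - pose proof (prod_cos_le_low u N ltac:(lra)). lra.
  - pose proof (H N HN u ltac:(lra)). lra.
Qed.

(** For [h = exp (- C1 w)] and [U = exp (C2 w)], the product [h U] grows exponentially in [w], which
    outweighs the division by [h]. *)
Lemma damping_eventually (C1 C2 : R) : 0 < C1 < C2 -> C1 <= 1 ->
  exists W, forall w, W <= w ->
    exp (- (2 * PI * exp (- (C1 * w)) * exp (C2 * w))) / exp (- (C1 * w)) <= exp (- w).
Proof.
  intros [H1 H2] H3. destruct (exp_dominates (C2 - C1) 2 ltac:(lra)) as [W HW].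
  exists (Rmax 1 W). intros w Hw.
  pose proof (Rmax_l 1 W). pose proof (Rmax_r 1 W).
  specialize (HW w ltac:(lra)).
  unfold Rdiv. rewrite <- exp_Ropp, Ropp_involutive, Rmult_assoc, <- !exp_plus.
  replace (- (C1 * w) + C2 * w) with ((C2 - C1) * w) by ring.
  apply exp_mono.
  assert (Hw5 : w <= w ^ 5).
  { change (w ^ 5) with (w * w ^ 4). pose proof (pow_R1_Rle w 4 ltac:(lra)). nra. }
  pose proof PI2_1. pose proof (exp_pos ((C2 - C1) * w)). nra.
Qed.

(** The cutoff [exp (C2 w)] lies far beyond [1/h], yet inside the range of the high-frequency bound.
    The intermediate [T] is fixed by [e] before [N] is taken large. *)
Lemma mean_poisson_uniform (C1 C2 e : R) : 0 < C1 < C2 -> C2 < 1 / ln 4 -> 0 < e ->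
  exists N0 : nat, forall N, (N0 <= N)%nat ->
    (forall x, Rabs (mean N (fun X => poisson (exp (- (C1 * ln (INR N) ^ 2))) (x - X)) - g x) <= e) /\
    (forall r x, exp (- (C1 * ln (INR N) ^ 2)) <= r -> mean N (fun X => poisson r (x - X)) <= 7).
Proof.
  intros HC HC2 He.
  assert (H1 : C1 <= 1).
  { pose proof ln_4_bounds as [H1 _].
    assert (1 / ln 4 <= 1); [|lra].
    unfold Rdiv. rewrite Rmult_1_l, <- Rinv_1. apply Rinv_le_contravar; lra. }
  destruct (prod_cos_majorant C2 ltac:(lra)) as [Na HNa].
  destruct (damping_eventually C1 C2 HC H1) as [W1 HW1].
  destruct (exp_neg_eventually 12 (e / 6) ltac:(lra)) as [T [HT0 HT]].
  specialize (HT T (Rle_refl _)).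
  destruct (exp_neg_eventually 2 (e / 6) ltac:(lra)) as [W2 [HW20 HW2]].
  destruct (exp_neg_eventually (16 * T ^ 2) (e / 6) ltac:(lra)) as [W3 [HW30 HW3]].
  destruct (Rinv_INR_eventually (64 * T ^ 3) (e / 6) ltac:(lra)) as [Nb [HNb1 HNb]].
  destruct (sq_ln_eventually (Rmax W1 (Rmax W2 (Rmax (W3 / C1) (T / C2))))) as [Nc HNc].
  exists (Na + Nb + Nc)%nat. intros N HN.
  specialize (HNa N ltac:(lia)). specialize (HNb N ltac:(lia)).
  destruct (HNc N ltac:(lia)) as [HN3 Hw]. clear HNc.
  set (w := ln (INR N) ^ 2) in *.
  assert (Hw1 := Rle_trans _ _ _ (Rmax_l _ _) Hw).
  apply (Rle_trans _ _ _ (Rmax_r _ _)) in Hw.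
  assert (Hw2 := Rle_trans _ _ _ (Rmax_l _ _) Hw).
  apply (Rle_trans _ _ _ (Rmax_r _ _)) in Hw.
  assert (Hw3 := Rle_trans _ _ _ (Rmax_l _ _) Hw).
  assert (Hw4 := Rle_trans _ _ _ (Rmax_r _ _) Hw). clear Hw.
  specialize (HW1 w Hw1). specialize (HW2 w Hw2).
  assert (Hw0 : 0 <= w) by lra.
  specialize (HW3 (C1 * w)).
  assert (HW3' : W3 <= C1 * w).
  { replace W3 with (C1 * (W3 / C1)) by (field; lra). apply Rmult_le_compat_l; lra. }
  specialize (HW3 HW3').
  assert (HTU : T <= exp (C2 * w)).
  { apply Rle_trans with (C2 * w).
    - replace T with (C2 * (T / C2)) by (field; lra). apply Rmult_le_compat_l; lra.
    - pose proof (exp_ineq1_le (C2 * w)). lra. }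
  set (h := exp (- (C1 * w))) in *. set (U := exp (C2 * w)) in *.
  set (eta := exp (- ((C2 + 1) * w))) in *.
  assert (HetaU : eta * U = exp (- w)).
  { unfold eta, U. rewrite <- exp_plus. f_equal. ring. }
  assert (Hh : 0 < h) by apply exp_pos.
  assert (Heta : 0 < eta) by apply exp_pos.
  assert (Hew : exp (- w) <= 1) by (rewrite <- exp_0; apply exp_mono; lra).
  assert (HN0 : 0 < INR N) by (apply lt_0_INR; lia).
  split.
  - intros x.
    eapply Rle_trans; [apply (mean_poisson_approx N h x T U eta); auto; try lra; lia|].
    rewrite HetaU.
    replace (2 * (T * (32 * T ^ 2 / INR N + 8 * h * T)))
      with (64 * T ^ 3 / INR N + 16 * T ^ 2 * h) by (field; lra).
    pose proof (exp_pos (- w)). lra.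
  - intros r x Hr.
    (* Since [exp (- w) <= 1], the bound is at most [1 + 2 (2 + 1) = 7]. *)
    eapply Rle_trans; [apply (mean_poisson_bound N h r x U eta); auto; lra|].
    rewrite HetaU. lra.
Qed.

Theorem theorem2p1 (C : R) :
  0 < C < 1 / ln 4 ->
  forall eps : R, 0 < eps ->
  exists N0 : nat, forall N : nat, (N0 <= N)%nat ->
  forall (lc rc : bool) (a b : R), a < b ->
    b - a > exp (- C * (ln (INR N)) ^ 2) ->
    Rabs (probXN N lc rc a b - RInt g a b) <= eps * (b - a).
Proof.
  intros HC eps Heps.
  (* Thirds of the gap from [C] to [1 / ln 4]: the smoothing width [exp (- C1 w)] is negligible
     against the interval, and the cutoff [exp (C2 w)] exceeds its inverse. *)
  set (C1 := (2 * C + 1 / ln 4) / 3). set (C2 := (C + 2 * (1 / ln 4)) / 3).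
  assert (HC1 : C < C1) by (unfold C1; lra).
  assert (HC2 : C1 < C2) by (unfold C1, C2; lra).
  assert (HC3 : C2 < 1 / ln 4) by (unfold C2; lra).
  clearbody C1 C2.
  destruct (mean_poisson_uniform C1 C2 (eps / 8) ltac:(lra) HC3 ltac:(lra)) as [Na HNa].
  (* The ratio of [r] to the length: [1/2] keeps the shrunk interval nondegenerate, and [eps / 32]
     turns [8 r] into a quarter of the allowed error. *)
  set (e1 := Rmin (1 / 2) (eps / 32)).
  assert (He1 : 0 < e1) by (apply Rmin_pos; lra).
  assert (He1a : e1 <= 1 / 2) by apply Rmin_l.
  assert (He1b : e1 <= eps / 32) by apply Rmin_r.
  (* The bound for [h / r]: [1] gives [h <= r], so the bound [7] applies at width [r], and
     [eps / 56] gives [2 (h/r) 7 <= eps / 4]. *)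
  set (q := Rmin 1 (eps / 56)).
  assert (Hq : 0 < q) by (apply Rmin_pos; lra).
  assert (Hqa : q <= 1) by apply Rmin_l.
  assert (Hqb : q <= eps / 56) by apply Rmin_r.
  destruct (exp_neg_eventually 1 (q * e1) ltac:(nra)) as [W [HW0 HW]].
  destruct (sq_ln_eventually (W / (C1 - C))) as [Nb HNb].
  exists (Na + Nb)%nat. intros N HN lc rc a b Hab Hlen.
  destruct (HNa N ltac:(lia)) as [Hg HB].
  destruct (HNb N ltac:(lia)) as [HN3 Hw].
  set (w := ln (INR N) ^ 2) in *.
  set (h := exp (- (C1 * w))) in *. assert (Hh : 0 < h) by apply exp_pos.
  set (r := e1 * (b - a)).
  assert (Hr : 0 < r) by (apply Rmult_lt_0_compat; lra).
  (* The length exceeds [exp (- C w)], so [h] is at most [exp (- (C1 - C) w)] times it, and this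
     factor is eventually below [q * e1]. *)
  assert (Hhr : h <= q * r).
  { assert (HW' : W <= (C1 - C) * w).
    { replace W with ((C1 - C) * (W / (C1 - C))) by (field; lra). apply Rmult_le_compat_l; lra. }
    specialize (HW _ HW'). rewrite Rmult_1_l in HW.
    replace h with (exp (- ((C1 - C) * w)) * exp (- C * w))
      by (unfold h; rewrite <- exp_plus; f_equal; ring).
    unfold r. rewrite <- Rmult_assoc.
    apply Rmult_le_compat; try (left; apply exp_pos); lra. }
  assert (Hhr' : h / r <= q).
  { apply Rmult_le_reg_r with r; [lra|]. replace (h / r * r) with h by (field; lra). exact Hhr. }
  eapply Rle_trans.
  { apply (probXN_sandwich N h r (eps / 8) 7); auto.
    - unfold r. nra.
    - intros x. apply HB. nra. }
  (* The enlarged interval has at most twice the length, so the shares of [eps] are [1/4] and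
     [2 (1/8 + 1/4) = 3/4]. *)
  apply Rle_trans with (8 * (eps / 32 * (b - a)) + (eps / 8 + 2 * (eps / 56) * 7) * (2 * (b - a))).
  - apply Rplus_le_compat.
    + apply Rmult_le_compat_l; [lra|]. apply Rmult_le_compat_r; lra.
    + assert (0 < h / r) by (apply Rdiv_lt_0_compat; auto).
      apply Rmult_le_compat; unfold r in *; nra.
  - right. field.
Qed.
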